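(* Assuming the Exponential Time Hypothesis, there is no $2^{o(k\log k)}\cdot n^{O(1)}$ time algorithm for Chromatic Number parameterized by vertex cover number, where $n$ is the number of vertices of the input graph.
   Context: A vertex cover of a graph $G$ is a set $C\subseteq V(G)$ containing at least one endpoint of every edge. $\chi(G)$ is the chromatic number of $G$ (the least $\ell$ such that $G$ admits a proper coloring with $\ell$ colors). Chromatic Number (parameterized by vertex cover): given a graph $G$ together with a vertex cover $C$ of size at most $k$ and a positive integer $\ell$, decide whether $\chi(G)\le\ell$; the parameter is $k$. The Exponential Time Hypothesis (ETH) states that there is no $2^{o(n)}$ time algorithm for 3SAT on $n$ variables. *)

(* Defs.v *)
From mathcomp Require Import all_boot all_order all_algebra.
From mathcomp Require Import all_classical all_reals all_analysis.

Set Implicit Arguments.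
Unset Strict Implicit.
Unset Printing Implicit Defensive.

Import Order.TTheory GRing.Theory Num.Theory numFieldNormedType.Exports.
Local Open Scope classical_set_scope.
Local Open Scope ring_scope.

(** ** Model of computation

  Algorithms are programs of the imperative language WHILE of N. D. Jones
  (Computability and Complexity from a Programming Perspective, MIT Press,
  1997): finitely many variables range over binary trees, and every
  constructor, projection, variable access, assignment and test costs one unit
  of time.  Trees are handled through pointers, so one unit corresponds to
  O(1) pointer operations, and trees can only be inspected by testing for
  [Leaf].  WHILE and multi-tape Turing machines simulate each other with
  polynomial overhead in the running time and the input size, and the time
  classes used below are insensitive to polynomial overhead. *)

Inductive tree : Type := Leaf | Node of tree & tree.

Definition left_tree (d : tree) : tree := if d is Node a _ then a else Leaf.
Definition right_tree (d : tree) : tree := if d is Node _ b then b else Leaf.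
Definition is_node (d : tree) : bool := if d is Node _ _ then true else false.

Inductive expr : Type :=
  | EVar of nat
  | ELeaf
  | ENode of expr & expr
  | ELeft of expr
  | ERight of expr.

Inductive cmd : Type :=
  | CAssign of nat & expr
  | CSeq of cmd & cmd
  | CIf of expr & cmd & cmd
  | CWhile of expr & cmd.

Definition store : Type := nat -> tree.

Definition update (s : store) (x : nat) (d : tree) : store :=
  fun y => if y == x then d else s y.

Fixpoint eval (e : expr) (s : store) : tree :=
  match e with
  | EVar x => s x
  | ELeaf => Leaf
  | ENode e1 e2 => Node (eval e1 s) (eval e2 s)
  | ELeft e1 => left_tree (eval e1 s)
  | ERight e1 => right_tree (eval e1 s)
  end.

Fixpoint expr_time (e : expr) : nat :=
  match e with
  | EVar _ => 1%N
  | ELeaf => 1%N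
  | ENode e1 e2 => (expr_time e1 + expr_time e2).+1
  | ELeft e1 => (expr_time e1).+1
  | ERight e1 => (expr_time e1).+1
  end.

(* [exec p s t s']: started in store [s], the program [p] halts after exactly
   [t] units of time in store [s']. *)
Inductive exec : cmd -> store -> nat -> store -> Prop :=
  | ExecAssign x e s :
      exec (CAssign x e) s (expr_time e).+1 (update s x (eval e s))
  | ExecSeq p q s t1 s1 t2 s2 :
      exec p s t1 s1 -> exec q s1 t2 s2 ->
      exec (CSeq p q) s (t1 + t2)%N s2
  | ExecIfTrue e p q s t s' :
      is_node (eval e s) -> exec p s t s' ->
      exec (CIf e p q) s (expr_time e + t).+1 s'
  | ExecIfFalse e p q s t s' :
      ~~ is_node (eval e s) -> exec q s t s' ->
      exec (CIf e p q) s (expr_time e + t).+1 s'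
  | ExecWhileTrue e p s t1 s1 t2 s2 :
      is_node (eval e s) -> exec p s t1 s1 -> exec (CWhile e p) s1 t2 s2 ->
      exec (CWhile e p) s (expr_time e + t1 + t2).+1 s2
  | ExecWhileFalse e p s :
      ~~ is_node (eval e s) ->
      exec (CWhile e p) s (expr_time e).+1 s.

(* Variable 0 holds the input at the start and the output at the end. *)
Definition input_store (d : tree) : store := update (fun=> Leaf) 0%N d.

(* [exec] is deterministic, so the existential below speaks of the one and only
   run of [p] on the input; the answer is "yes" iff the output is not [Leaf]. *)
Definition decides_in_time (R : realType) (I : Type) (enc : I -> tree)
    (yes : I -> bool) (bound : I -> R) (p : cmd) : Prop :=
  forall x : I, exists (t : nat) (s : store),
    [/\ exec p (input_store (enc x)) t s,
        t%:R <= bound x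
      & is_node (s 0%N) = yes x].

(** ** Encodings *)

Fixpoint enc_nat (n : nat) : tree :=
  if n is m.+1 then Node Leaf (enc_nat m) else Leaf.

Definition enc_bool (b : bool) : tree := if b then Node Leaf Leaf else Leaf.

Definition enc_seq (T : Type) (enc : T -> tree) (s : seq T) : tree :=
  foldr (fun x d => Node (enc x) d) Leaf s.

(** ** 3SAT and the Exponential Time Hypothesis *)

(* The literal [(i, b)] holds under an assignment iff variable [i] has
   value [b]. *)
Definition literal (n : nat) : Type := ('I_n * bool)%type.
Definition clause (n : nat) : Type := seq (literal n).
Definition cnf (n : nat) : Type := seq (clause n).

Definition satisfies (n : nat) (a : {ffun 'I_n -> bool}) (phi : cnf n) : bool :=
  all (fun C : clause n => has (fun l : literal n => a l.1 == l.2) C) phi.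

(* A formula is a set of clauses: without the exclusion of repetitions its size
   would not be bounded in terms of the number of variables, and no running
   time depending on the latter only would be possible at all. *)
Record sat3_instance : Type := Sat3Instance {
  sat3_nvars : nat;
  sat3_cnf : cnf sat3_nvars;
  sat3_width : all (fun C : clause sat3_nvars => (size C <= 3)%N) sat3_cnf;
  sat3_uniq : uniq (sat3_cnf : seq (seq ('I_sat3_nvars * bool)))
}.

Definition satisfiable (x : sat3_instance) : bool :=
  [exists a : {ffun 'I_(sat3_nvars x) -> bool}, satisfies a (sat3_cnf x)].

Definition enc_literal (n : nat) (l : literal n) : tree :=
  Node (enc_nat l.1) (enc_bool l.2).

Definition enc_sat3 (x : sat3_instance) : tree :=
  Node (enc_nat (sat3_nvars x))
       (enc_seq (enc_seq (@enc_literal _)) (sat3_cnf x)).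

Definition ETH (R : realType) : Prop :=
  ~ exists (p : cmd) (f : nat -> R),
      f =o_\oo (fun n : nat => n%:R : R) /\
      decides_in_time enc_sat3 satisfiable
        (fun x => 2 `^ f (sat3_nvars x)) p.

(** ** Chromatic Number parameterized by vertex cover *)

Record sgraph (n : nat) : Type := SGraph {
  adj :> rel 'I_n;
  adj_sym : symmetric adj;
  adj_irrefl : irreflexive adj
}.

Definition colorable (n : nat) (G : sgraph n) (l : nat) : bool :=
  [exists f : {ffun 'I_n -> 'I_l},
    [forall x, forall y, G x y ==> (f x != f y)]].

Lemma colorable_exists (n : nat) (G : sgraph n) : exists l, colorable G l.
Proof.
exists n; apply/existsP; exists [ffun x => x].
apply/forallP => x; apply/forallP => y; apply/implyP => Gxy.
by rewrite !ffunE; apply: contraTneq Gxy => ->; rewrite adj_irrefl.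
Qed.

Definition chromatic_number (n : nat) (G : sgraph n) : nat :=
  ex_minn (colorable_exists G).

Definition vertex_cover (n : nat) (G : sgraph n) (C : {set 'I_n}) : bool :=
  [forall x, forall y, G x y ==> (x \in C) || (y \in C)].

Record chromatic_instance : Type := ChromaticInstance {
  ci_order : nat;
  ci_graph : sgraph ci_order;
  ci_cover : {set 'I_ci_order};
  ci_k : nat;
  ci_l : nat;
  ci_coverP : vertex_cover ci_graph ci_cover;
  ci_cover_size : (#|ci_cover| <= ci_k)%N;
  ci_l_gt0 : (0 < ci_l)%N
}.

Definition chromatic_yes (x : chromatic_instance) : bool :=
  (chromatic_number (ci_graph x) <= ci_l x)%N.

(* The graph is given by its adjacency matrix and the cover by its
   characteristic vector. *)
Definition enc_graph (n : nat) (G : sgraph n) : tree :=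
  enc_seq (fun x => enc_seq (fun y => enc_bool (G x y)) (enum 'I_n))
    (enum 'I_n).

Definition enc_vset (n : nat) (C : {set 'I_n}) : tree :=
  enc_seq (fun x => enc_bool (x \in C)) (enum 'I_n).

Definition enc_chromatic (x : chromatic_instance) : tree :=
  Node (enc_graph (ci_graph x))
    (Node (enc_vset (ci_cover x)) (Node (enc_nat (ci_k x)) (enc_nat (ci_l x)))).

(* Main.v *)
From HB Require Import structures.
Require Import Defs.
From mathcomp Require Import all_boot all_order all_algebra.
From mathcomp Require Import all_classical all_reals all_analysis.
From mathcomp Require Import zify ring lra.

(** A 3SAT formula with [n] variables is turned in polynomial time into a graph
  with [n^O(1)] vertices and a vertex cover of size [k = O(n / log n)], so that
  [k log k = O(n)] and an algorithm of running time [2^o(k log k) n^O(1)] for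
  the chromatic number would solve 3SAT in time [2^o(n)].

  The variables are split into [O(n / log n)] groups of at most [b] variables,
  where [4^b] is about [n].  For each of three copies [s] there is a palette of
  [2^b] vertices, one for each word of [b] bits; the [3 * 2^b] palette vertices
  form a clique, and they are all the colours available.  For each group [g] and
  copy [s] there is a vertex adjacent to the palettes of the two other copies,
  so that its colour is a word of copy [s], that is, a valuation of the
  variables of [g].  These vertices form the cover.  Whenever giving the values
  [w0], [w1], [w2] to the groups [g0], [g1], [g2] contradicts itself or falsifies
  a clause, an independent vertex adjacent to the three group vertices
  [(0, g0)], [(1, g1)], [(2, g2)] and to the whole palette except [(0, w0)],
  [(1, w1)], [(2, w2)] forbids it.  Three copies are needed because such a vertex
  sees only the set of the colours of its neighbours; the forbidden
  contradictions also make the copies agree with each other.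

  The reduction is written in a total functional language whose programs are
  compiled to WHILE.  Time and output size are polynomial as soon as each
  iteration adds a polynomial amount to its accumulator. *)

Set Implicit Arguments.
Unset Strict Implicit.
Unset Printing Implicit Defensive.

Local Open Scope nat_scope.

(** * A functional language compiled to WHILE *)

Inductive fn : Type :=
  | FId
  | FLeaf
  | FNode of fn & fn
  | FLeft of fn
  | FRight of fn
  | FIf of fn & fn & fn
  | FComp of fn & fn
  | FFold of fn & fn & fn.

(** [g] receives the whole remaining suffix, which is what the loop variable of the compiled code
    holds. On a unary number the suffix is the current value of a countdown. *)
Fixpoint tfold (g : tree -> tree -> tree) (acc t : tree) : tree :=
  if t is Node _ r then tfold g (g t acc) r else acc.

Fixpoint run (f : fn) (x : tree) : tree :=
  match f with
  | FId => x
  | FLeaf => Leaf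
  | FNode f g => Node (run f x) (run g x)
  | FLeft f => left_tree (run f x)
  | FRight f => right_tree (run f x)
  | FIf f g h => if is_node (run f x) then run g x else run h x
  | FComp f g => run f (run g x)
  | FFold l i b =>
      tfold (fun t acc => run b (Node t (Node acc x))) (run i x) (run l x)
  end.

(** The 14 covers the test and the three assignments of an iteration, the 2 the final failing
    test. *)
Fixpoint tcost (g : tree -> tree -> tree) (h : tree -> tree -> nat)
    (acc t : tree) : nat :=
  if t is Node _ r then 14 + h t acc + tcost g h (g t acc) r else 2.

Fixpoint cost (f : fn) (x : tree) : nat :=
  match f with
  | FId => 2
  | FLeaf => 2
  | FNode f g => 8 + cost f x + cost g x
  | FLeft f => 3 + cost f x
  | FRight f => 3 + cost f x
  | FIf f g h => 4 + cost f x + cost g x + cost h x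
  | FComp f g => cost g x + cost f (run g x)
  | FFold l i b => 6 + cost l x + cost i x +
      tcost (fun t acc => run b (Node t (Node acc x)))
        (fun t acc => cost b (Node t (Node acc x))) (run i x) (run l x)
  end.

Fixpoint height (f : fn) : nat :=
  match f with
  | FId => 0
  | FLeaf => 0
  | FNode f g => 2 + (height f + height g)
  | FLeft f => height f
  | FRight f => height f
  | FIf f g h => 1 + (height f + height g + height h)
  | FComp f g => height f + height g
  | FFold l i b => 3 + (height l + height i + height b)
  end.

(* The code reads its argument from variable [d] and writes its result there;
   the variables above [d] are scratch, those below [d] are left alone. *)
Fixpoint compile (f : fn) (d : nat) : cmd :=
  match f with
  | FId => CAssign d (EVar d)
  | FLeaf => CAssign d ELeaf
  | FNode f g =>
      CSeq (CAssign d.+1 (EVar d)) (CSeq (compile f d.+1)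
      (CSeq (CAssign d.+2 (EVar d)) (CSeq (compile g d.+2)
      (CAssign d (ENode (EVar d.+1) (EVar d.+2))))))
  | FLeft f => CSeq (compile f d) (CAssign d (ELeft (EVar d)))
  | FRight f => CSeq (compile f d) (CAssign d (ERight (EVar d)))
  | FIf f g h =>
      CSeq (CAssign d.+1 (EVar d)) (CSeq (compile f d.+1)
      (CIf (EVar d.+1) (compile g d) (compile h d)))
  | FComp f g => CSeq (compile g d) (compile f d)
  | FFold l i b =>
      CSeq (CAssign d.+1 (EVar d)) (CSeq (compile l d.+1)
      (CSeq (CAssign d.+2 (EVar d)) (CSeq (compile i d.+2)
      (CSeq (CWhile (EVar d.+1)
        (CSeq (CAssign d.+3 (ENode (EVar d.+1) (ENode (EVar d.+2) (EVar d))))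
        (CSeq (compile b d.+3)
        (CSeq (CAssign d.+2 (EVar d.+3))
        (CAssign d.+1 (ERight (EVar d.+1)))))))
      (CAssign d (EVar d.+2))))))
  end.

Definition keeps (d h : nat) (s s' : store) : Prop :=
  forall y, (y < d) || (d + h < y) -> s' y = s y.

Definition runs_to (c : cmd) (s : store) (T d h : nat) (r : tree) : Prop :=
  exists t s', [/\ exec c s t s', t <= T, s' d = r & keeps d h s s'].

Lemma update_eq s x d : update s x d x = d.
Proof. by rewrite /update eqxx. Qed.

Lemma update_neq s x d y : y != x -> update s x d y = s y.
Proof. by rewrite /update => /negbTE ->. Qed.

(** Wherever the argument is needed again, a subprogram runs on a copy in a higher variable, and
    [keeps] ensures that the original survives. Hence the induction quantifies over [d] and [s]. *)
Lemma compile_correct f d s :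
  runs_to (compile f d) s (cost f (s d)) d (height f) (run f (s d)).
Proof.
elim: f d s => [||f IHf g IHg|f IHf|f IHf|f IHf g IHg h IHh|f IHf g IHg
  |l IHl i IHi b IHb] d s /=.
- do 2!eexists; split; [exact: ExecAssign| by [] | by rewrite update_eq|].
  by move=> y /= hy; rewrite update_neq //; lia.
- do 2!eexists; split; [exact: ExecAssign| by [] | by rewrite update_eq|].
  by move=> y /= hy; rewrite update_neq //; lia.
- set s1 := update s d.+1 (s d).
  have [t2 [s2 [e2 b2 r2 k2]]] := IHf d.+1 s1.
  have s2d : s2 d = s d by rewrite k2 /s1 ?update_neq //; lia.
  set s3 := update s2 d.+2 (s d).
  have [t4 [s4 [e4 b4 r4 k4]]] := IHg d.+2 s3.
  have s4d1 : s4 d.+1 = run f (s d).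
    by rewrite k4 /s3 ?update_neq ?r2 /s1 ?update_eq //; lia.
  do 2!eexists; split.
  + apply: ExecSeq; first exact: ExecAssign.
    apply: ExecSeq; first exact: e2.
    apply: ExecSeq; first exact: ExecAssign.
    rewrite /= s2d; apply: ExecSeq; first exact: e4.
    exact: ExecAssign.
  + rewrite /=; move: b2 b4; rewrite /s1 /s3 !update_eq; lia.
  + by rewrite update_eq /= s4d1 r4 /s3 update_eq.
  + move=> y /= hy.
    rewrite update_neq ?k4 /s3 ?update_neq ?k2 /s1 ?update_neq //; lia.
- have [t2 [s2 [e2 b2 r2 k2]]] := IHf d s.
  do 2!eexists; split.
  + by apply: ExecSeq; [exact: e2|exact: ExecAssign].
  + rewrite /=; lia.
  + by rewrite update_eq /= r2.
  + by move=> y /= hy; rewrite update_neq ?k2 //; lia.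
- have [t2 [s2 [e2 b2 r2 k2]]] := IHf d s.
  do 2!eexists; split.
  + by apply: ExecSeq; [exact: e2|exact: ExecAssign].
  + rewrite /=; lia.
  + by rewrite update_eq /= r2.
  + by move=> y /= hy; rewrite update_neq ?k2 //; lia.
- set s1 := update s d.+1 (s d).
  have [t2 [s2 [e2 b2 r2 k2]]] := IHf d.+1 s1.
  have s2d : s2 d = s d by rewrite k2 /s1 ?update_neq //; lia.
  rewrite /s1 update_eq in b2 r2.
  have [c|c] := boolP (is_node (run f (s d))).
  + have [t3 [s3 [e3 b3 r3 k3]]] := IHg d s2.
    rewrite s2d in b3 r3.
    do 2!eexists; split.
    * apply: ExecSeq; first exact: ExecAssign.
      apply: ExecSeq; first exact: e2.
      by apply: ExecIfTrue; [rewrite /= r2|exact: e3].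
    * rewrite /=; lia.
    * by [].
    * by move=> y /= hy; rewrite k3 ?k2 /s1 ?update_neq //; lia.
  + have [t3 [s3 [e3 b3 r3 k3]]] := IHh d s2.
    rewrite s2d in b3 r3.
    do 2!eexists; split.
    * apply: ExecSeq; first exact: ExecAssign.
      apply: ExecSeq; first exact: e2.
      by apply: ExecIfFalse; [rewrite /= r2|exact: e3].
    * rewrite /=; lia.
    * by [].
    * by move=> y /= hy; rewrite k3 ?k2 /s1 ?update_neq //; lia.
- have [t2 [s2 [e2 b2 r2 k2]]] := IHg d s.
  have [t3 [s3 [e3 b3 r3 k3]]] := IHf d s2.
  rewrite r2 in b3 r3.
  do 2!eexists; split; [by apply: ExecSeq; [exact: e2|exact: e3]|lia|by []|].
  by move=> y /= hy; rewrite k3 ?k2 //; lia.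
- set s1 := update s d.+1 (s d).
  have [t2 [s2 [e2 b2 r2 k2]]] := IHl d.+1 s1.
  have s2d : s2 d = s d by rewrite k2 /s1 ?update_neq //; lia.
  set s3 := update s2 d.+2 (s d).
  have [t4 [s4 [e4 b4 r4 k4]]] := IHi d.+2 s3.
  have s4d1 : s4 d.+1 = run l (s d).
    by rewrite k4 /s3 ?update_neq ?r2 /s1 ?update_eq //; lia.
  have s4d : s4 d = s d by rewrite k4 /s3 ?update_neq //; lia.
  rewrite /s1 update_eq in b2 r2; rewrite /s3 update_eq in b4 r4.
  have ks4 : keeps d (height (FFold l i b)) s s4.
    by move=> y /= hy; rewrite k4 /s3 ?update_neq ?k2 /s1 ?update_neq //; lia.
  pose g t acc := run b (Node t (Node acc (s d))).
  pose hc t acc := cost b (Node t (Node acc (s d))).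
  set body := CSeq (CAssign d.+3 _) _.
  (* Loop invariant: [d.+1] holds the remaining list, [d.+2] the accumulator, [d] the
     environment. *)
  have loop u acc z : z d.+1 = u -> z d.+2 = acc -> z d = s d ->
      keeps d (height (FFold l i b)) s z ->
      exists t z', [/\ exec (CWhile (EVar d.+1) body) z t z',
        t <= tcost g hc acc u, z' d.+2 = tfold g acc u
        & keeps d (height (FFold l i b)) s z'].
    elim: u acc z => [|a _ r IHr] acc z zu za zd kz.
      do 2!eexists; split; [|idtac|exact: za|exact: kz].
        by apply: ExecWhileFalse; rewrite /= zu.
      by [].
    set z1 := update z d.+3 (Node (Node a r) (Node acc (s d))).
    have [t5 [z2 [e5 b5 r5 k5]]] := IHb d.+3 z1.
    rewrite /z1 update_eq in b5 r5.
    set z3 := update z2 d.+2 (z2 d.+3).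
    set z4 := update z3 d.+1 r.
    have z4d1 : z4 d.+1 = r by rewrite /z4 update_eq.
    have z4d2 : z4 d.+2 = g (Node a r) acc.
      by rewrite /z4 /z3 update_neq ?update_eq ?r5 //; lia.
    have z4d : z4 d = s d.
      by rewrite /z4 /z3 !update_neq ?k5 /z1 ?update_neq //; lia.
    have kz4 : keeps d (height (FFold l i b)) s z4.
      move=> y /= hy; have := kz y hy => <-.
      by rewrite /z4 /z3 !update_neq ?k5 /z1 ?update_neq //; lia.
    have [t6 [z5 [e6 b6 r6 k6]]] := IHr _ _ z4d1 z4d2 z4d kz4.
    do 2!eexists; split.
    + apply: ExecWhileTrue; [by rewrite /= zu| |exact: e6].
      apply: ExecSeq; first exact: ExecAssign.
      rewrite /= zu za zd -/z1; apply: ExecSeq; first exact: e5.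
      apply: ExecSeq; first exact: ExecAssign.
      rewrite /= -/z3.
      have z3d1 : z3 d.+1 = Node a r.
        by rewrite /z3 update_neq ?k5 /z1 ?update_neq ?zu //; lia.
      have -> : z4 = update z3 d.+1 (Defs.eval (ERight (EVar d.+1)) z3).
        by rewrite /= z3d1.
      exact: ExecAssign.
    + rewrite /=; move: b6; rewrite /hc; lia.
    + exact: r6.
    + exact: k6.
  have [t5 [s5 [e5 b5 r5 k5]]] := loop _ _ _ s4d1 r4 s4d ks4.
  do 2!eexists; split.
  + apply: ExecSeq; first exact: ExecAssign.
    apply: ExecSeq; first exact: e2.
    apply: ExecSeq; first exact: ExecAssign.
    rewrite /= s2d; apply: ExecSeq; first exact: e4.
    apply: ExecSeq; first exact: e5.
    exact: ExecAssign.
  + rewrite /=; move: b5; rewrite /g /hc; lia.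
  + by rewrite update_eq /= r5.
  + by move=> y /= hy; rewrite update_neq ?k5 //; lia.
Qed.

(** There is no skip command; assigning variable 0 to itself stands in for it. *)
Fixpoint clear_vars (h : nat) : cmd :=
  if h is h'.+1 then CSeq (CAssign h'.+1 ELeaf) (clear_vars h')
  else CAssign 0 (EVar 0).

Lemma exec_clear_vars h s :
  (forall y, h < y -> s y = Leaf) ->
  exec (clear_vars h) s (2 * h.+1) (input_store (s 0)).
Proof.
elim: h s => [|h IH] s sL /=.
  have -> : input_store (s 0) = update s 0 (Defs.eval (EVar 0) s).
    apply: functional_extensionality_dep => y; rewrite /input_store /update /=.
    by case: eqP => // ye; rewrite sL //; lia.
  exact: ExecAssign.
have -> : 2 * h.+2 = 2 + 2 * h.+1 by lia.
apply: ExecSeq; first exact: ExecAssign.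
have -> : s 0 = update s h.+1 (Defs.eval ELeaf s) 0 by rewrite update_neq.
apply: IH => y hy; rewrite /update; case: eqP => // ye; apply: sL; lia.
Qed.

(** The compiled code leaves garbage in its scratch variables, whereas the behaviour of [p] is known
    only from stores that are [Leaf] outside variable 0; hence the cleaning in between. *)
Definition after (f : fn) (p : cmd) : cmd :=
  CSeq (compile f 0) (CSeq (clear_vars (height f)) p).

Lemma exec_after f p x t s :
  exec p (input_store (run f x)) t s ->
  exists2 t', exec (after f p) (input_store x) t' s &
    t' <= cost f x + 2 * (height f).+1 + t.
Proof.
move=> ep; have [t1 [s1 [e1 b1 r1 k1]]] := compile_correct f 0 (input_store x).
rewrite [input_store x 0]update_eq in b1 r1.
eexists.
- apply: ExecSeq; first exact: e1.
  apply: ExecSeq; first apply: exec_clear_vars.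
    by move=> y /= hy; rewrite k1 /input_store ?update_neq //; lia.
  rewrite r1; exact: ep.
- lia.
Qed.

(** * Polynomial time *)

Fixpoint tsize (t : tree) : nat :=
  if t is Node a b then (tsize a + tsize b).+1 else 1.

(** The base is at least 2, as [tsize] is positive, so a single power dominates any polynomial,
    constant factors included. *)
Definition polyb (h : tree -> nat) : Prop :=
  exists e, forall x, h x <= (tsize x).+1 ^ e.

Lemma tsize_gt0 t : 0 < tsize t.
Proof. by case: t. Qed.

Lemma tsize_left t : tsize (left_tree t) <= tsize t.
Proof. case: t => //= a b; lia. Qed.

Lemma tsize_right t : tsize (right_tree t) <= tsize t.
Proof. case: t => //= a b; lia. Qed.

Lemma leq_base_exp m n e : m <= n -> m ^ e <= n ^ e.
Proof. by case: e => // e; rewrite leq_exp2r. Qed.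

Lemma polyb_le h h' : (forall x, h x <= h' x) -> polyb h' -> polyb h.
Proof. by move=> le [e he]; exists e => x; exact: leq_trans (le x) (he x). Qed.

Lemma polyb_const n : polyb (fun=> n).
Proof.
exists n => x; apply: leq_trans (ltnW (ltn_expl n (ltnSn 1))) _.
by apply: leq_base_exp; rewrite ltnS tsize_gt0.
Qed.

Lemma polyb_tsize : polyb tsize.
Proof. by exists 1 => x; rewrite expn1 leqnSn. Qed.

Lemma polyb_mul h h' : polyb h -> polyb h' -> polyb (fun x => h x * h' x).
Proof.
by move=> [e he] [e' he']; exists (e + e') => x; rewrite expnD; apply: leq_mul.
Qed.

Lemma polyb_add h h' : polyb h -> polyb h' -> polyb (fun x => h x + h' x).
Proof.
(* The extra factor is at least 2, and [u + v <= 2 * u * v] for positive [u] and [v]. *)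
move=> [e he] [e' he']; exists (e + e').+1 => x.
have := he x; have := he' x; rewrite expnS expnD.
have : 0 < (tsize x).+1 ^ e by rewrite expn_gt0.
have : 0 < (tsize x).+1 ^ e' by rewrite expn_gt0.
have := tsize_gt0 x; nia.
Qed.

Lemma polyb_exp h e : polyb h -> polyb (fun x => h x ^ e).
Proof.
by move=> [e' he]; exists (e' * e) => x; rewrite expnM leq_base_exp.
Qed.

Lemma polyb_comp h r :
  polyb h -> polyb (fun x => tsize (r x)) -> polyb (fun x => h (r x)).
Proof.
move=> [e he] pr; have [e' he'] := polyb_exp e (polyb_add pr (polyb_const 1)).
by exists e' => x; apply: leq_trans (he _) _; rewrite -addn1; apply: he'.
Qed.

Definition poly (f : fn) : Prop :=
  polyb (cost f) /\ polyb (fun x => tsize (run f x)).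

Lemma poly_id : poly FId.
Proof. by split; [exact: polyb_const|exact: polyb_tsize]. Qed.

Lemma poly_leaf : poly FLeaf.
Proof. by split; exact: polyb_const. Qed.

Lemma poly_node f g : poly f -> poly g -> poly (FNode f g).
Proof.
move=> [cf sf] [cg sg]; split.
  by apply: polyb_add => //; apply: polyb_add => //; exact: polyb_const.
apply: (@polyb_le _ (fun x => 1 + (tsize (run f x) + tsize (run g x)))) => //=.
by apply: polyb_add; [exact: polyb_const|exact: polyb_add].
Qed.

Lemma poly_left f : poly f -> poly (FLeft f).
Proof.
move=> [cf sf]; split; first by apply: polyb_add => //; exact: polyb_const.
by apply: polyb_le sf => x; exact: tsize_left.
Qed.

Lemma poly_right f : poly f -> poly (FRight f).
Proof.
move=> [cf sf]; split; first by apply: polyb_add => //; exact: polyb_const.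
by apply: polyb_le sf => x; exact: tsize_right.
Qed.

Lemma poly_if f g h : poly f -> poly g -> poly h -> poly (FIf f g h).
Proof.
move=> [cf sf] [cg sg] [ch sh]; split.
  by do 3!apply: polyb_add => //; exact: polyb_const.
apply: polyb_le (polyb_add sg sh) => x /=; case: ifP => _; lia.
Qed.

Lemma poly_comp f g : poly f -> poly g -> poly (FComp f g).
Proof.
move=> [cf sf] [cg sg]; split; first by apply: polyb_add => //; exact: polyb_comp.
exact: (polyb_comp sf).
Qed.

Lemma tfold_inv g h (Inv : tree -> tree -> Prop) M acc t :
  (forall acc a r, Inv acc (Node a r) ->
     h (Node a r) acc <= M /\ Inv (g (Node a r) acc) r) ->
  Inv acc t ->
  tcost g h acc t <= tsize t * (14 + M) + 2 /\ Inv (tfold g acc t) Leaf.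
Proof.
move=> step; elim: t acc => [|a _ r IH] acc /=; first by split; [lia|].
move=> /step[hM /IH[cr ir]]; split=> //.
rewrite mulSn mulnDl; lia.
Qed.

(** Polynomial steps iterated polynomially often can still build an exponentially large accumulator.
    The invariant has to exclude this by bounding the accumulator by [h]; then every run of the body
    has polynomial cost. *)
Lemma poly_fold l i b (Inv : tree -> tree -> tree -> Prop) (h : tree -> nat) :
  poly l -> poly i -> poly b -> polyb h ->
  (forall x, Inv x (run i x) (run l x)) ->
  (forall x acc a r, Inv x acc (Node a r) ->
     Inv x (run b (Node (Node a r) (Node acc x))) r) ->
  (forall x acc t, Inv x acc t -> tsize acc <= h x) ->
  poly (FFold l i b).
Proof.
move=> [cl sl] [ci si] [[e ce] sb] ph inv0 invS invh.
(* [M] bounds the cost of one run of the body; the 3 counts the two [Node]s that build its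
   environment and the successor in [polyb]. *)
pose M x := (tsize (run l x) + (h x + (tsize x + 3))) ^ e.
have pM : polyb M.
  apply: polyb_exp; do !apply: polyb_add => //.
    exact: polyb_tsize.
  exact: polyb_const.
have loop x : tcost (fun t acc => run b (Node t (Node acc x)))
      (fun t acc => cost b (Node t (Node acc x))) (run i x) (run l x)
      <= tsize (run l x) * (14 + M x) + 2 /\
    tsize (run (FFold l i b) x) <= h x.
  have [||c [I _]] := @tfold_inv (fun t acc => run b (Node t (Node acc x)))
    (fun t acc => cost b (Node t (Node acc x)))
    (fun acc t => Inv x acc t /\ tsize t <= tsize (run l x)) (M x)
    (run i x) (run l x).
  - move=> acc a r [I] /= sr; split; last by split; [exact: invS|lia].
    have hx := invh _ _ _ I; apply: leq_trans (ce _) _ => /=.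
    rewrite /M leq_base_exp //; lia.
  - by split.
  - by split; [exact: c|exact: invh I].
split; last by apply: polyb_le ph => x; have [] := loop x.
apply: (@polyb_le _ (fun x => 6 + cost l x + cost i x +
  (tsize (run l x) * (14 + M x) + 2))) => [x /=|].
  by rewrite leq_add2l; have [] := loop x.
by do !(apply: polyb_add || apply: polyb_mul) => //; exact: polyb_const.
Qed.

Lemma poly_fold_add l i b (hd : tree -> nat) :
  poly l -> poly i -> poly b -> polyb hd ->
  (forall t acc x,
     tsize (run b (Node t (Node acc x))) <= tsize acc + hd (Node t x)) ->
  poly (FFold l i b).
Proof.
move=> pl pi pbb [e he] step.
pose D x := (tsize (run l x) + (tsize x + 2)) ^ e.
pose T x := tsize (run i x) + tsize (run l x) * D x.
(* The size of the accumulator, plus [D x] for every unit of size of the remaining list, is a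
   potential that never increases. *)
apply: (@poly_fold _ _ _ (fun x acc t => tsize t <= tsize (run l x) /\
  tsize acc + tsize t * D x <= T x) T) => //.
- case: pl pi => _ sl [_ si]; apply: polyb_add => //; apply: polyb_mul => //.
  apply: polyb_exp; do !apply: polyb_add => //.
    exact: polyb_tsize.
  exact: polyb_const.
- move=> x acc a r [/= sr sT]; split; first lia.
  have := leq_trans (step (Node a r) acc x) (leq_add (leqnn _) (he _)) => /= st.
  have H : ((tsize a + tsize r).+1 + tsize x).+2 ^ e <= D x.
    by rewrite /D leq_base_exp //; lia.
  have := tsize_gt0 a; nia.
- by move=> x acc t [_]; lia.
Qed.

(** * Lists, environments and loops over lists *)

Fixpoint items (t : tree) : seq tree :=
  if t is Node a b then a :: items b else [::].

Fixpoint of_seq (s : seq tree) : tree :=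
  if s is a :: r then Node a (of_seq r) else Leaf.

Lemma of_seqK : cancel of_seq items.
Proof. by elim=> //= a s ->. Qed.

Lemma itemsK : cancel items of_seq.
Proof. by elim=> //= a _ b ->. Qed.

Lemma enc_seqE T (enc : T -> tree) s : enc_seq enc s = of_seq (map enc s).
Proof. by elim: s => //= a s <-. Qed.

(* Environments are lists: [FVar k] is the entry number [k] of the argument. *)
Definition FVar (k : nat) : fn := FLeft (iter k FRight FId).

Definition FTrue : fn := FNode FLeaf FLeaf.

Definition FList (s : seq fn) : fn := foldr FNode FLeaf s.

Definition FCall (f : fn) (s : seq fn) : fn := FComp f (FList s).

(* Evaluates [e] in the environment extended by the current list element,
   hiding the two entries pushed by [FFold]. *)
Definition FElem (e : fn) : fn :=
  FComp e (FNode (FLeft (FVar 0)) (FRight (FRight FId))).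

Definition FRevCat (f g : fn) : fn :=
  FFold f g (FNode (FLeft (FVar 0)) (FVar 1)).

(** The inner fold pushes the results in reverse and the outer [FRevCat] restores the order, which
    matters when adjacency matrix and cover are listed along the same vertices. *)
Definition FFor (l e : fn) : fn :=
  FRevCat (FFold l FLeaf (FRevCat (FElem e) (FVar 1))) FLeaf.

Definition FHas (l e : fn) : fn :=
  FFold l FLeaf (FIf (FElem e) FTrue (FVar 1)).

Lemma tfold_items g acc t :
  tfold (fun u a => g (left_tree u) a) acc t = foldl (fun a u => g u a) acc (items t).
Proof. by elim: t acc => //= a _ b IH acc. Qed.

Lemma run_FRevCat f g x :
  run (FRevCat f g) x = of_seq (catrev (items (run f x)) (items (run g x))).
Proof.
rewrite /= (tfold_items Node) -[X in foldl _ X _]itemsK.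
by elim: (items (run f x)) (items (run g x)) => [|a s IH] r //=; exact: (IH (a :: r)).
Qed.

Lemma run_FFor l e x :
  run (FFor l e) x =
  of_seq (flatten [seq items (run e (Node a x)) | a <- items (run l x)]).
Proof.
rewrite /FFor run_FRevCat [run FLeaf x]/= catrevE cats0; congr of_seq.
rewrite [run (FFold _ _ _) x](_ : _ = tfold (fun t acc =>
   of_seq (catrev (items (run e (Node (left_tree t) x))) (items acc)))
   Leaf (run l x)); last first.
  rewrite -[LHS]/(tfold (fun t acc => run (FRevCat (FElem e) (FVar 1))
    (Node t (Node acc x))) Leaf (run l x)).
  congr (tfold _ _ _); apply: functional_extensionality_dep => t.
  by apply: functional_extensionality_dep => acc; rewrite run_FRevCat.
rewrite (tfold_items (fun t acc =>
   of_seq (catrev (items (run e (Node t x))) (items acc)))).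
suff H r : rev (items (foldl (fun acc t =>
    of_seq (catrev (items (run e (Node t x))) (items acc))) r
    (items (run l x)))) =
  rev (items r) ++ flatten [seq items (run e (Node a x)) | a <- items (run l x)].
  exact: H.
elim: (items (run l x)) r => [|a s IH] r /=; first by rewrite cats0.
by rewrite IH of_seqK catrevE rev_cat revK catA.
Qed.

Lemma run_FHas l e x :
  run (FHas l e) x =
  enc_bool (has (fun a => is_node (run e (Node a x))) (items (run l x))).
Proof.
rewrite /FHas /= (tfold_items (fun t acc =>
  if is_node (run e (Node t x)) then Node Leaf Leaf else acc)).
suff H c : foldl (fun acc t => if is_node (run e (Node t x)) then Node Leaf Leaf
    else acc) (enc_bool c) (items (run l x)) =
  enc_bool (c || has (fun a => is_node (run e (Node a x))) (items (run l x))).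
  exact: (H false).
elim: (items (run l x)) c => [|a s IH] c /=; first by rewrite orbF.
case: ifP => _ /=; first by rewrite (IH true) !orbT.
by rewrite IH.
Qed.

Lemma poly_var k : poly (FVar k).
Proof.
apply: poly_left; elim: k => [|k IH]; [exact: poly_id|exact: poly_right].
Qed.

Lemma poly_true : poly FTrue.
Proof. by apply: poly_node; exact: poly_leaf. Qed.

Lemma poly_elem e : poly e -> poly (FElem e).
Proof.
move=> pe; apply: poly_comp => //; apply: poly_node.
  exact/poly_left/poly_var.
exact/poly_right/poly_right/poly_id.
Qed.

Lemma poly_revcat f g : poly f -> poly g -> poly (FRevCat f g).
Proof.
move=> pf pg; apply: (@poly_fold_add _ _ _ (fun x => tsize x)) => //.
- by apply: poly_node; [exact/poly_left/poly_var|exact: poly_var].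
- exact: polyb_tsize.
- by move=> t acc x /=; have := tsize_left t; lia.
Qed.

Lemma tsize_catrev s r :
  tsize (of_seq (catrev s r)) <= tsize (of_seq s) + tsize (of_seq r).
Proof. elim: s r => [|a s IH] r //=.
have := IH (a :: r) => /=.
lia. Qed.

Lemma poly_for l e : poly l -> poly e -> poly (FFor l e).
Proof.
move=> pl pe; apply: poly_revcat; last exact: poly_leaf.
apply: (@poly_fold_add _ _ _ (fun y =>
  tsize (run e (run (FNode (FLeft (FVar 0)) (FRight FId)) y)))) => //.
- exact: poly_leaf.
- by apply: poly_revcat; [exact: poly_elem|exact: poly_var].
- have [_] // : poly (FComp e (FNode (FLeft (FVar 0)) (FRight FId))).
  apply: poly_comp => //; apply: poly_node; first exact/poly_left/poly_var.
  exact/poly_right/poly_id.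
- move=> t acc x; rewrite run_FRevCat; apply: leq_trans (tsize_catrev _ _) _.
  by rewrite !itemsK /= addnC.
Qed.

Lemma poly_has l e : poly l -> poly e -> poly (FHas l e).
Proof.
move=> pl pe; apply: (@poly_fold_add _ _ _ (fun=> 3)) => //.
- exact: poly_leaf.
- apply: poly_if; [exact: poly_elem|exact: poly_true|exact: poly_var].
- exact: polyb_const.
- by move=> t acc x /=; case: ifP => _ //=; lia.
Qed.

(** * Equality, logarithms, words and groups *)

Fixpoint tree_eqb (a b : tree) : bool :=
  match a, b with
  | Leaf, Leaf => true
  | Node a1 a2, Node b1 b2 => tree_eqb a1 b1 && tree_eqb a2 b2
  | _, _ => false
  end.

Lemma tree_eqbP : Equality.axiom tree_eqb.
Proof.
elim=> [|a1 IH1 a2 IH2] [|b1 b2] /=; try by constructor.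
apply: (iffP andP) => [[/IH1 -> /IH2 ->]|[<- <-]] //.
by split; [apply/IH1|apply/IH2].
Qed.

HB.instance Definition _ := hasDecEq.Build tree tree_eqbP.

Lemma is_node_enc_bool b : is_node (enc_bool b) = b.
Proof. by case: b. Qed.

Lemma items_enc_nat n : items (enc_nat n) = nseq n Leaf.
Proof. by elim: n => //= n ->. Qed.

Lemma size_items_enc_nat n : size (items (enc_nat n)) = n.
Proof. by rewrite items_enc_nat size_nseq. Qed.

Lemma run_FCall f s x : run (FCall f s) x = run f (of_seq [seq run g x | g <- s]).
Proof. by rewrite /FCall /=; congr run; elim: s => //= g s ->. Qed.

Lemma run_FList s x : run (FList s) x = of_seq [seq run g x | g <- s].
Proof. by elim: s => //= g s ->. Qed.

Definition FOr (f g : fn) : fn := FIf f FTrue g.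
Definition FNot (f : fn) : fn := FIf f FLeaf FTrue.

Lemma poly_or f g : poly f -> poly g -> poly (FOr f g).
Proof. by move=> pf pg; apply: poly_if => //; exact: poly_true. Qed.

Lemma poly_not f : poly f -> poly (FNot f).
Proof.
by move=> pf; apply: poly_if => //; [exact: poly_leaf|exact: poly_true].
Qed.

Lemma poly_fcall f s : poly f -> poly (FList s) -> poly (FCall f s).
Proof. exact: poly_comp. Qed.

Lemma poly_nil : poly (FList [::]).
Proof. exact: poly_leaf. Qed.

Lemma poly_cons f s : poly f -> poly (FList s) -> poly (FList (f :: s)).
Proof. exact: poly_node. Qed.

Ltac poly_tac := repeat first
  [ exact: poly_id | exact: poly_leaf | exact: poly_true | exact: poly_var
  | assumption | solve [auto with poly]
  | apply: poly_or | apply: poly_not | apply: poly_for | apply: poly_has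
  | apply: poly_revcat | apply: poly_fcall | exact: poly_nil
  | apply: poly_cons
  | apply: poly_if | apply: poly_comp
  | apply: poly_node | apply: poly_left | apply: poly_right ].

(** The fold runs down the right spine of the first tree; the accumulator pairs a flag with what is
    left of the second tree, and [f] compares the heads. *)
Definition FEqStep (f : fn) : fn :=
  FNode
    (FIf (FLeft (FVar 1))
      (FIf (FRight (FVar 1))
        (FCall f [:: FLeft (FVar 0); FLeft (FRight (FVar 1))])
        FLeaf)
      FLeaf)
    (FRight (FRight (FVar 1))).

Definition FEqEnd : fn :=
  FIf (FLeft FId) (FIf (FRight FId) FLeaf FTrue) FLeaf.

(** Without general recursion, equality is programmed for left nesting of depth at most [k] only;
    [k = 3] suffices for every comparison of the reduction. *)
Fixpoint FEq (k : nat) : fn :=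
  if k is k'.+1 then
    FComp FEqEnd (FFold (FVar 0) (FNode FTrue (FVar 1)) (FEqStep (FEq k')))
  else FTrue.

(** Only left edges count, so forming a list costs one level whatever its length. *)
Fixpoint rank (t : tree) : nat :=
  if t is Node a b then maxn (rank a).+1 (rank b) else 0.

Lemma run_FEq k a b : rank a <= k -> rank b <= k ->
  run (FEq k) (of_seq [:: a; b]) = enc_bool (a == b).
Proof.
elim: k a b => [|k IH] a b.
  by case: a => [|a1 a2]; case: b => [|b1 b2] //=; rewrite ?geq_max.
suff H y c : rank a <= k.+1 -> rank b <= k.+1 ->
    run FEqEnd (tfold (fun t acc => run (FEqStep (FEq k)) (Node t (Node acc y)))
      (Node (enc_bool c) b) a) = enc_bool (c && (a == b)) by exact: (H _ true).
set g := fun t acc => _.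
elim: a c b => [|a1 _ a2 IHa] c b ra rb; first by case: c; case: b {rb}.
move: ra; rewrite [rank _]/= geq_max => /andP[ra1 ra2].
rewrite -[tfold g _ _]/(tfold g (g (Node a1 a2) (Node (enc_bool c) b)) a2).
have -> : g (Node a1 a2) (Node (enc_bool c) b) =
    Node (enc_bool (c && (is_node b && (a1 == left_tree b)))) (right_tree b).
  rewrite /g /=; case: c => //=; case: b rb => [|b1 b2] //= rb.
  rewrite -[Node a1 _]/(of_seq [:: a1; b1]) IH //.
  by move: rb; rewrite geq_max => /andP[].
rewrite IHa //; last first.
  by case: b rb => //= b1 b2; rewrite geq_max => /andP[].
by congr enc_bool; case: b {rb} => [|b1 b2] /=; case: c.
Qed.

Lemma poly_FEqStep f : poly f -> (forall x, tsize (run f x) <= 3) ->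
  poly (FFold (FVar 0) (FNode FTrue (FVar 1)) (FEqStep f)).
Proof.
move=> pf le3.
apply: (@poly_fold_add _ _ _ (fun=> 4)); [poly_tac|poly_tac| |exact: polyb_const|].
  by rewrite /FEqStep; poly_tac.
move=> t acc x.
have sr : tsize (right_tree (right_tree acc)) <= tsize acc.
  exact: leq_trans (tsize_right _) (tsize_right _).
rewrite /=; case: ifP => _ /=; last lia.
case: ifP => _ /=; last lia.
have := le3 (Node (left_tree t) (Node (left_tree (right_tree acc)) Leaf)); lia.
Qed.

Lemma poly_FEq k : poly (FEq k).
Proof.
elim: k => [|k IH]; first exact: poly_true.
apply: poly_comp; first by rewrite /FEqEnd; poly_tac.
apply: poly_FEqStep => // x.
by case: (k) => //= k'; do 2?[case: ifP => //= _].
Qed.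
#[local] Hint Resolve poly_FEq : poly.

Definition FMem : fn := FHas (FVar 1) (FCall (FEq 3) [:: FVar 0; FVar 1]).

Definition flat (x : tree) : bool := rank x <= 3.

Lemma run_FMem x l : flat x -> all flat (items l) ->
  run FMem (of_seq [:: x; l]) = enc_bool (x \in items l).
Proof.
move=> fx /allP fl; rewrite run_FHas; congr enc_bool.
rewrite -has_pred1; apply: eq_in_has => a al.
by rewrite run_FCall [map _ _]/= run_FEq ?is_node_enc_bool //; exact: fl.
Qed.

Lemma poly_FMem : poly FMem.
Proof. by apply: poly_has; poly_tac. Qed.

Lemma flatten_filter T (c : pred T) (s : seq T) :
  flatten [seq if c x then [::] else [:: x] | x <- s] =
  [seq x <- s | ~~ c x].
Proof. by elim: s => //= x s ->; case: (c x). Qed.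

(** After [m] steps the accumulator holds the halves of [m] rounded down and up; a step swaps them
    and increments the one that was rounded down. *)
Definition FHalf : fn :=
  FComp (FLeft FId)
    (FFold (FVar 0) (FNode FLeaf FLeaf)
      (FNode (FRight (FVar 1)) (FNode FLeaf (FLeft (FVar 1))))).

Lemma run_FHalf t x : run FHalf (Node t x) = enc_nat (size (items t))./2.
Proof.
rewrite -[RHS]/(left_tree (Node (enc_nat (0 + size (items t))./2)
  (enc_nat (uphalf (0 + size (items t)))))).
rewrite -[LHS]/(left_tree (tfold
  (fun _ acc => Node (right_tree acc) (Node Leaf (left_tree acc)))
  (Node (enc_nat 0./2) (enc_nat (uphalf 0))) t)); congr left_tree.
elim: t 0 => [|a _ b IH] m /=; first by rewrite addn0.
by rewrite addnS -addSn -IH.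
Qed.

Lemma poly_FHalf : poly FHalf.
Proof.
apply: poly_comp; first by poly_tac.
apply: (@poly_fold_add _ _ _ (fun=> 4)); [poly_tac..|exact: polyb_const|].
by move=> t [|a b] x /=; lia.
Qed.

Lemma ex_log4 n : exists b, n < 4 ^ b.
Proof. by exists n; exact: ltn_expl. Qed.

(** Base 4 keeps the number [2 ^ log4 n] of words of the order of the square root of [n], which is
    small against [n / log n]. *)
Definition log4 (n : nat) : nat := ex_minn (ex_log4 n).

Lemma log4_ub n : n < 4 ^ log4 n.
Proof. by rewrite /log4; case: ex_minnP. Qed.

Lemma log4_min n b : n < 4 ^ b -> log4 n <= b.
Proof. by rewrite /log4; case: ex_minnP => m _ mmin /mmin. Qed.

Lemma log4_lb n : 0 < log4 n -> 4 ^ (log4 n).-1 <= n.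
Proof.
move=> l0; rewrite leqNgt; apply/negP => /log4_min; lia.
Qed.

(** Counts divisions by 4 until the quotient vanishes. The [n] available iterations suffice, as
    [log4 n <= n], and the surplus ones do nothing. *)
Definition FLog : fn :=
  FComp (FRight FId)
    (FFold (FVar 0) (FNode (FVar 0) FLeaf)
      (FIf (FLeft (FVar 1))
        (FNode (FCall FHalf [:: FCall FHalf [:: FLeft (FVar 1)]])
          (FNode FLeaf (FRight (FVar 1))))
        (FVar 1))).

Lemma run_FLog t x : run FLog (Node t x) = enc_nat (log4 (size (items t))).
Proof.
set n := size (items t).
pose g (_ acc : tree) := if is_node (left_tree acc) then
  Node (enc_nat (size (items (left_tree acc)))./2./2)
    (Node Leaf (right_tree acc)) else acc.
have -> : run FLog (Node t x) = right_tree (tfold g (Node t Leaf) t).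
  rewrite -[LHS]/(right_tree (tfold _ (Node t Leaf) t)).
  congr (right_tree (tfold _ _ _)).
  apply: functional_extensionality_dep => u.
  apply: functional_extensionality_dep => acc.
  rewrite -[LHS]/(if is_node (left_tree acc)
    then Node (run FHalf (Node (run FHalf (Node (left_tree acc) Leaf)) Leaf))
      (Node Leaf (right_tree acc)) else acc).
  by rewrite /g !run_FHalf size_items_enc_nat.
suff H u j y : size (items y) = n %/ 4 ^ j -> j <= log4 n ->
    log4 n <= j + size (items u) ->
    right_tree (tfold g (Node y (enc_nat j)) u) = enc_nat (log4 n).
  apply: (H t 0 t) => //; first by rewrite divn1.
  by apply: log4_min; exact: ltn_expl.
elim: u j y => [|a _ b IH] j y sy jl lj.
  by rewrite addn0 in lj; rewrite /=; congr enc_nat; lia.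
rewrite -[tfold _ _ _]/(tfold g (g (Node a b) (Node y (enc_nat j))) b).
have isy : is_node y = (4 ^ j <= n).
  by rewrite -divn_gt0 ?expn_gt0 // -sy; case: (y).
rewrite /g /= isy; case: leqP => jn.
  apply: (IH j.+1).
  - by rewrite size_items_enc_nat sy -!divn2 -!divnMA expnSr mulnA.
  - by rewrite -(ltn_exp2l _ _ (isT : 1 < 4)) (leq_ltn_trans jn) // log4_ub.
  - by move: lj => /=; lia.
have := log4_min jn => lnj; apply: IH => //; lia.
Qed.

Lemma poly_FLog : poly FLog.
Proof.
apply: poly_comp; first by poly_tac.
have := poly_FHalf => pH.
apply: (@poly_fold_add _ _ _ (fun=> 8)); [poly_tac..| |exact: polyb_const|].
  by poly_tac.
move=> t acc x.
rewrite -[run _ _]/(if is_node (left_tree acc)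
    then Node (run FHalf (Node (run FHalf (Node (left_tree acc) Leaf)) Leaf))
      (Node Leaf (right_tree acc)) else acc).
rewrite !run_FHalf size_items_enc_nat; case: acc => [|y z] //=.
case: ifP => _ /=; last lia.
have sz_enc n : tsize (enc_nat n) = 2 * n + 1 by elim: n => //= n ->; lia.
have sz_items u : 2 * size (items u) + 1 <= tsize u.
  elim: u => //= u _ v; have := tsize_gt0 u; lia.
rewrite /= sz_enc; have := sz_items y.
set m := size _; have : m./2./2 <= m by rewrite -!divn2 -divnMA leq_div.
lia.
Qed.
#[local] Hint Resolve poly_FMem poly_FHalf poly_FLog : poly.

(** * Binary words of a given length *)

Fixpoint words (b : nat) : seq (seq bool) :=
  if b is b'.+1 then
    flatten [seq [:: false :: w; true :: w] | w <- words b']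
  else [:: [::]].

Lemma mem_words b w : (w \in words b) = (size w == b).
Proof.
elim: b w => [|b IH] w /=; first by rewrite inE size_eq0.
apply/flatten_mapP/idP => [[v]|].
  by rewrite IH !inE => /eqP <- /orP[] /eqP ->.
case: w => // c w; rewrite eqSS => sw; exists w; first by rewrite IH.
by case: c; rewrite !inE eqxx ?orbT.
Qed.

Lemma size_words b : size (words b) = 2 ^ b.
Proof.
elim: b => //= b; rewrite expnS => <-.
by elim: (words b) => //= w s IH; rewrite IH; lia.
Qed.

Lemma uniq_words b : uniq (words b).
Proof.
elim: b => //= b; elim: (words b) => //= w s IH /andP[ws /IH us].
have nin c : c :: w \notin flatten [seq [:: false :: v; true :: v] | v <- s].
  apply: contra ws => /flatten_mapP[v vs].
  by rewrite !inE => /orP[] /eqP[_ ->].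
by rewrite !inE !negb_or !nin us andbT.
Qed.

Definition enc_word (w : seq bool) : tree := of_seq (map enc_bool w).

Lemma enc_word_inj : injective enc_word.
Proof.
move=> v w /(can_inj of_seqK) /inj_map; apply.
by apply: (can_inj (g := is_node)) => b; rewrite is_node_enc_bool.
Qed.

Definition FWordsStep : fn :=
  FFor (FVar 1) (FList [:: FNode FLeaf (FVar 0); FNode FTrue (FVar 0)]).

Definition FWords : fn :=
  FFold (FCall FLog [:: FVar 0]) (FList [:: FLeaf]) FWordsStep.

Lemma run_FWordsStep t acc x : run FWordsStep (Node t (Node acc x)) =
  of_seq (flatten [seq [:: Node Leaf a; Node (Node Leaf Leaf) a]
    | a <- items acc]).
Proof. by rewrite run_FFor. Qed.

Lemma run_FWords n x :
  run FWords (Node (enc_nat n) x) = of_seq (map enc_word (words (log4 n))).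
Proof.
pose g (_ acc : tree) := of_seq (flatten
  [seq [:: Node Leaf a; Node (Node Leaf Leaf) a] | a <- items acc]).
have -> : run FWords (Node (enc_nat n) x) =
    tfold g (Node Leaf Leaf) (run FLog (Node (enc_nat n) Leaf)).
  rewrite -[LHS]/(tfold (fun t acc => run FWordsStep
      (Node t (Node acc (Node (enc_nat n) x))))
    (Node Leaf Leaf) (run FLog (Node (enc_nat n) Leaf))).
  congr (tfold _ _ _).
  apply: functional_extensionality_dep => u.
  by apply: functional_extensionality_dep => acc; rewrite run_FWordsStep.
rewrite run_FLog size_items_enc_nat.
suff H j b : tfold g (of_seq (map enc_word (words j))) (enc_nat b) =
    of_seq (map enc_word (words (j + b))) by exact: (H 0).
elim: b j => [|b IH] j; first by rewrite addn0.
rewrite addnS -addSn -IH [LHS]/=; congr tfold.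
rewrite /g of_seqK; congr of_seq => /=.
by elim: (words j) => //= w s ->.
Qed.

(** The accumulator doubles in length at each step, so its growth is not additive. After [j] of the
    [log4 n] steps its size is at most [3 * 5 ^ j]; moreover [5 ^ j <= 16 ^ j] is at most the square
    of [4 ^ log4 n], which is linear in the input. *)
Lemma poly_FWords : poly FWords.
Proof.
pose n x := size (items (left_tree x)).
have nx x : n x <= tsize x.
  apply: leq_trans (tsize_left x); rewrite /n.
  by elim: (left_tree x) => //= u _ v; lia.
have lE x : run (FCall FLog [:: FVar 0]) x = enc_nat (log4 (n x)).
  by rewrite run_FCall [map _ _]/= run_FLog.
apply: (@poly_fold _ _ _ (fun x acc t =>
  exists2 j, j + size (items t) = log4 (n x) & tsize acc <= 3 * 5 ^ j)
  (fun x => 3 * (4 * tsize x + 1) ^ 2)).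
- by poly_tac.
- by poly_tac.
- by rewrite /FWordsStep; poly_tac.
- apply: polyb_mul; [exact: polyb_const|apply: polyb_exp].
  apply: polyb_add; last exact: polyb_const.
  by apply: polyb_mul; [exact: polyb_const|exact: polyb_tsize].
- by move=> x; exists 0 => //; rewrite lE size_items_enc_nat.
- move=> x acc a r [j jr sa]; exists j.+1; first by rewrite -jr /= addnS addSn.
  rewrite run_FWordsStep expnS.
  suff : tsize (of_seq (flatten [seq [:: Node Leaf u; Node (Node Leaf Leaf) u]
      | u <- items acc])) <= 5 * tsize acc by lia.
  elim: (acc) => //= u _ v; have := tsize_gt0 u; lia.
- move=> x acc t [j jl sa]; apply: leq_trans sa _; rewrite leq_mul2l /=.
  have jlog : j <= log4 (n x) by lia.
  have h16 : 5 ^ j <= (4 ^ log4 (n x)) ^ 2.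
    rewrite -expnM mulnC expnM.
    apply: leq_trans (_ : 16 ^ j <= _); first exact: leq_base_exp.
    by rewrite leq_exp2l.
  apply: leq_trans h16 (leq_base_exp _ _).
  have [->|l0] := posnP (log4 (n x)); first by lia.
  have := log4_lb l0; rewrite -[in 4 ^ log4 _](prednK l0) expnS.
  have := nx x; lia.
Qed.
#[local] Hint Resolve poly_FWords : poly.

(** Variables are dealt out from [m.-1] down to 0: [cur] is the group being filled, [r] its number
    of free places, [closed] holds the complete groups. *)
Fixpoint fill (b m r : nat) (cur : seq nat) (closed : seq (seq nat)) :
    seq (seq nat) :=
  if m is m'.+1 then
    if r is r'.+1 then fill b m' r' (m' :: cur) closed
    else fill b m' b.-1 [:: m'] (cur :: closed)
  else cur :: closed.

Definition groups (n : nat) : seq (seq nat) :=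
  fill (log4 n) n (log4 n) [::] [::].

Lemma mem_fill b m r cur closed i :
  (i \in flatten (fill b m r cur closed)) =
  (i < m) || (i \in flatten (cur :: closed)).
Proof.
elim: m r cur closed => [|m IH] r cur closed //=.
case: r => [|r]; rewrite IH ltnS [i <= m]leq_eqVlt /= !inE;
  by case: (i == m); rewrite ?orbT.
Qed.

Lemma fill_size b m r cur closed : 0 < b -> r + size cur = b ->
  all (fun g => size g == b) closed ->
  all (fun g => size g <= b) (fill b m r cur closed) /\
  (size (fill b m r cur closed)).-1 * b <= m + size closed * b + size cur.
Proof.
move=> b0; elim: m r cur closed => [|m IH] r cur closed rb ac /=.
  split; last by lia.
  apply/andP; split; first by lia.
  by apply: sub_all ac => g /eqP ->.
case: r rb => [|r] rb.
  have [||h1 h2] := IH b.-1 [:: m] (cur :: closed).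
  - by rewrite /=; lia.
  - by rewrite /= ac andbT; apply/eqP; lia.
  by split=> //; move: h2 => /=; lia.
have [||h1 h2] := IH r (m :: cur) closed => //; first by rewrite /=; lia.
by split=> //; move: h2 => /=; lia.
Qed.

Lemma log4_gt0 n : 0 < n -> 0 < log4 n.
Proof. by move=> n0; have := log4_ub n; case: (log4 n) => //; lia. Qed.

Lemma groups_size n : all (fun g => size g <= log4 n) (groups n) /\
  (size (groups n)).-1 * log4 n <= n.
Proof.
rewrite /groups; case: n => [|n]; first by split.
have [|||h1 h2] := @fill_size (log4 n.+1) n.+1 (log4 n.+1) [::] [::].
- exact: log4_gt0.
- by rewrite addn0.
- by [].
- by split=> //; move: h2; rewrite mul0n !addn0.
Qed.

(** Even [n = 0] yields one, empty, group. A group that always exists will pad clauses with fewer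
    than three literals. *)
Lemma groups_gt0 n : 0 < size (groups n).
Proof.
rewrite /groups; move: (log4 n) {2}(log4 n) [::] [::] => b r cur closed.
by elim: n r cur closed => [|n IH] r cur closed //=; case: r.
Qed.

Definition enc_group (g : seq nat) : tree := of_seq (map enc_nat g).

(** The accumulator is [r] paired with the list [cur :: closed], so closing a group amounts to
    consing a new one. Entry 3 of the environment is the capacity [b]. *)
Definition FGroupsStep : fn :=
  FIf (FLeft (FVar 1))
    (FNode (FRight (FLeft (FVar 1)))
      (FNode (FNode (FRight (FVar 0)) (FLeft (FRight (FVar 1))))
        (FRight (FRight (FVar 1)))))
    (FNode (FRight (FVar 3))
      (FNode (FNode (FRight (FVar 0)) FLeaf)
        (FRight (FVar 1)))).

Definition FGroups : fn :=
  FComp (FRight FId)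
    (FFold (FVar 0) (FNode (FVar 1) (FNode FLeaf FLeaf)) FGroupsStep).

Lemma run_FGroups n b x :
  run FGroups (Node (enc_nat n) (Node (enc_nat b) x)) =
  of_seq (map enc_group (fill b n b [::] [::])).
Proof.
set y := Node _ _.
pose g t acc := run FGroupsStep (Node t (Node acc y)).
suff H m r cur closed :
    right_tree (tfold g (Node (enc_nat r)
      (Node (enc_group cur) (of_seq (map enc_group closed)))) (enc_nat m)) =
    of_seq (map enc_group (fill b m r cur closed)) by exact: (H n b [::] [::]).
elim: m r cur closed => [|m IH] r cur closed //.
case: r => [|r].
  rewrite -[fill _ _ _ _ _]/(fill b m b.-1 [:: m] (cur :: closed)) -IH.
  by case: (b) @y @g {IH}.
by rewrite -[fill _ _ _ _ _]/(fill b m r (m :: cur) closed) -IH.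
Qed.

Lemma poly_FGroups : poly FGroups.
Proof.
apply: poly_comp; first by poly_tac.
apply: (@poly_fold_add _ _ _ (fun x => 10 + tsize x)).
- by poly_tac.
- by poly_tac.
- by rewrite /FGroupsStep; poly_tac.
- by apply: polyb_add; [exact: polyb_const|exact: polyb_tsize].
- move=> t acc x.
  have sB := leq_trans (tsize_right _)
    (leq_trans (tsize_left (right_tree x)) (tsize_right x)).
  have st := tsize_right t.
  rewrite /=; case: ifP => _ /=; last first.
    by move: sB; have := tsize_right acc; lia.
  case: acc => [|r [|cur done]] /=; try lia; have := tsize_right r; lia.
Qed.
#[local] Hint Resolve poly_FGroups : poly.

(** * The program of the reduction *)

Lemma run_FForE l e x s f :
  run l x = of_seq s ->
  (forall a, a \in s -> run e (Node a x) = of_seq (f a)) ->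
  run (FFor l e) x = of_seq (flatten [seq f a | a <- s]).
Proof.
move=> rl re; rewrite run_FFor rl of_seqK; congr (of_seq (flatten _)).
by apply/eq_in_map => a /re ->; rewrite of_seqK.
Qed.

Lemma run_FForE1 l e x s f :
  run l x = of_seq s ->
  (forall a, a \in s -> run e (Node a x) = of_seq [:: f a]) ->
  run (FFor l e) x = of_seq [seq f a | a <- s].
Proof. by move=> rl re; rewrite -flatten_map1; exact: run_FForE. Qed.

Lemma run_filter l c x s p :
  run l x = of_seq s ->
  (forall a, a \in s -> run c (Node a x) = enc_bool (~~ p a)) ->
  run (FFor l (FIf c FLeaf (FList [:: FVar 0]))) x = of_seq [seq a <- s | p a].
Proof.
move=> rl rc; rewrite (eq_filter (a2 := fun a => ~~ ~~ p a)); last first.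
  by move=> a; rewrite negbK.
rewrite -(flatten_filter (fun a => ~~ p a)); apply: run_FForE rl _ => a /rc rca.
rewrite -[LHS]/(if is_node (run c (Node a x)) then Leaf else of_seq [:: a]).
by rewrite rca is_node_enc_bool; case: ifP.
Qed.

Lemma rank_left t : rank (left_tree t) <= rank t.
Proof. case: t => //= a b; lia. Qed.

Lemma rank_right t : rank (right_tree t) <= rank t.
Proof. case: t => //= a b; lia. Qed.

Lemma rank_of_seq k s : all (fun t => rank t < k) s -> rank (of_seq s) <= k.
Proof. by elim: s => //= t s IH /andP[tk /IH sk]; rewrite geq_max tk. Qed.

Lemma rank_enc_nat n : rank (enc_nat n) <= 1.
Proof. by elim: n => //= n IH; rewrite geq_max. Qed.

Lemma rank_enc_bool b : rank (enc_bool b) <= 1.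
Proof. by case: b. Qed.

Definition tags : seq tree := [:: enc_nat 0; enc_nat 1; enc_nat 2].
Definition FTags : fn := FList [:: FLeaf; FTrue; FNode FLeaf FTrue].

Lemma run_FTags x : run FTags x = of_seq tags.
Proof. by []. Qed.

Lemma poly_FTags : poly FTags.
Proof. by rewrite /FTags; poly_tac. Qed.
#[local] Hint Resolve poly_FTags : poly.

(* A vertex is a [Node] of an identifier, which is [Leaf] outside the cover, and
   a list of identifiers of neighbours; each edge is listed at one end at
   least.  [pid] and [gid] identify palette and group vertices. *)
Definition pid (s w : tree) : tree := Node Leaf (Node s w).
Definition gid (s g : tree) : tree := Node (Node Leaf Leaf) (Node s g).
Definition tag (q : tree) : tree := left_tree (right_tree q).

Definition FPid (s w : fn) : fn := FNode FLeaf (FNode s w).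
Definition FGid (s g : fn) : fn := FNode FTrue (FNode s g).
Definition FTag (q : fn) : fn := FLeft (FRight q).

(** * Palette and group vertices *)

Definition pal (W : seq tree) : seq tree := [seq pid s w | s <- tags, w <- W].

Definition FPal : fn :=
  FFor FTags (FFor (FVar 1) (FList [:: FPid (FVar 1) (FVar 0)])).

Lemma run_FPal W x : run FPal (Node (of_seq W) x) = of_seq (pal W).
Proof.
by apply: run_FForE (run_FTags _) _ => s _; apply: run_FForE1.
Qed.

Lemma poly_FPal : poly FPal.
Proof. by rewrite /FPal /FPid; poly_tac. Qed.

Definition palV (P : seq tree) : seq tree :=
  [seq Node p (of_seq [seq q <- P | q != p]) | p <- P].

Definition FOthers : fn :=
  FFor (FVar 1) (FIf (FCall (FEq 3) [:: FVar 0; FVar 1]) FLeaf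
    (FList [:: FVar 0])).

Definition FPalV : fn :=
  FFor (FVar 0) (FList [:: FNode (FVar 0) FOthers]).

Lemma run_FPalV P x : all flat P ->
  run FPalV (Node (of_seq P) x) = of_seq (palV P).
Proof.
move=> /allP fP; apply: run_FForE1 => // p pP.
rewrite -[LHS]/(of_seq [:: Node p (run FOthers (Node p (Node (of_seq P) x)))]).
congr (of_seq [:: Node p _]); apply: run_filter => // q qP.
rewrite [~~ _]/= negbK run_FCall [map _ _]/= run_FEq //; exact: fP.
Qed.

Lemma poly_FPalV : poly FPalV.
Proof. by rewrite /FPalV /FOthers; poly_tac. Qed.

Definition grpV (G P : seq tree) : seq tree :=
  [seq Node (gid s g) (of_seq [seq q <- P | tag q != s]) | s <- tags, g <- G].

Definition FOtherTags : fn :=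
  FFor (FVar 3) (FIf (FCall (FEq 3) [:: FTag (FVar 0); FVar 2]) FLeaf
    (FList [:: FVar 0])).

Definition FGrpV : fn :=
  FFor FTags (FFor (FVar 1)
    (FList [:: FNode (FGid (FVar 1) (FVar 0)) FOtherTags])).

Lemma flat_tags s : s \in tags -> flat s.
Proof. by rewrite !inE => /or3P[] /eqP ->. Qed.

Lemma flat_tag q : flat q -> flat (tag q).
Proof. exact: leq_trans (leq_trans (rank_left _) (rank_right _)). Qed.

Lemma run_FGrpV G P x : all flat P ->
  run FGrpV (Node (of_seq G) (Node (of_seq P) x)) = of_seq (grpV G P).
Proof.
move=> /allP fP; apply: run_FForE (run_FTags _) _ => s sT.
apply: run_FForE1 => // g gG.
rewrite -[LHS]/(of_seq [:: Node (gid s g) (run FOtherTags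
  (Node g (Node s (Node (of_seq G) (Node (of_seq P) x)))))]).
congr (of_seq [:: Node _ _]); apply: run_filter => // q qP.
rewrite [~~ _]/= negbK run_FCall [map _ _]/= run_FEq //.
  exact/flat_tag/fP.
exact: flat_tags.
Qed.

Lemma poly_FGrpV : poly FGrpV.
Proof. by rewrite /FGrpV /FOtherTags  /FGid /FTag; poly_tac. Qed.

(** These are the literals made true when group [g] takes the value [w]. [zip] drops the surplus
    bits of [w], and [rev] reflects the order in which the fold pushes. *)
Definition lits (g w : tree) : seq tree :=
  rev [seq Node p.1 p.2 | p <- zip (items g) (items w)].

Definition FZipStep : fn :=
  FNode (FRight (FLeft (FVar 1)))
    (FNode (FNode (FLeft (FVar 0)) (FLeft (FLeft (FVar 1))))
      (FRight (FVar 1))).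

Definition FZip : fn :=
  FComp (FRight FId) (FFold (FVar 0) (FNode (FVar 1) FLeaf) FZipStep).

Lemma run_FZip g w x : size (items g) <= size (items w) ->
  run FZip (Node g (Node w x)) = of_seq (lits g w).
Proof.
suff H y u v r : size (items u) <= size (items v) ->
    right_tree (tfold (fun t acc => run FZipStep (Node t (Node acc y)))
      (Node v (of_seq r)) u) =
    of_seq (catrev [seq Node p.1 p.2 | p <- zip (items u) (items v)] r).
  exact: (H _ g w [::]).
elim: u v r => [|a _ u IH] [|b v] r //=; rewrite ltnS => uv.
exact: (IH v (Node a b :: r)).
Qed.

Lemma poly_FZip : poly FZip.
Proof.
apply: poly_comp; first by poly_tac.
apply: (@poly_fold_add _ _ _ (fun x => 4 + tsize x)).
- by poly_tac.
- by poly_tac.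
- by rewrite /FZipStep; poly_tac.
- by apply: polyb_add; [exact: polyb_const|exact: polyb_tsize].
- move=> t acc x; have := tsize_left t.
  by case: acc => [|[|a b] c] /=; lia.
Qed.
#[local] Hint Resolve poly_FPal poly_FPalV poly_FGrpV poly_FZip : poly.

(* An item records that the group [g] takes the value [w] in copy [s]. *)
Definition item (s g w : tree) : tree :=
  Node (gid s g) (Node (pid s w) (of_seq (lits g w))).
Definition item_g (x : tree) : tree := left_tree x.
Definition item_p (x : tree) : tree := left_tree (right_tree x).
Definition item_lits (x : tree) : tree := right_tree (right_tree x).

Definition item_list (s : tree) (G W : seq tree) : seq tree :=
  [seq item s g w | g <- G, w <- W].

Definition FItems : fn :=
  FFor (FVar 1) (FFor (FVar 3) (FList [::
    FNode (FGid (FVar 2) (FVar 1))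
      (FNode (FPid (FVar 2) (FVar 0)) (FCall FZip [:: FVar 1; FVar 0]))])).

Lemma run_FItems s G W x :
  (forall g w, g \in G -> w \in W -> size (items g) <= size (items w)) ->
  run FItems (Node s (Node (of_seq G) (Node (of_seq W) x))) =
  of_seq (item_list s G W).
Proof.
move=> gw; apply: run_FForE => // g gG; apply: run_FForE1 => // w wW.
rewrite -[LHS]/(of_seq [:: Node (gid s g) (Node (pid s w)
  (run FZip (of_seq [:: g; w])))]).
by rewrite run_FZip ?gw.
Qed.

Lemma poly_FItems : poly FItems.
Proof. by rewrite /FItems /FGid /FPid; poly_tac. Qed.

(** * Contradictions, falsified clauses and triple vertices *)

Definition tneg (l : tree) : tree :=
  Node (left_tree l) (if is_node (right_tree l) then Leaf else Node Leaf Leaf).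

Definition FNeg (l : fn) : fn :=
  FNode (FLeft l) (FIf (FRight l) FLeaf FTrue).

Definition bad (L : seq tree) (cls : tree) : bool :=
  has (fun l => tneg l \in L) L ||
  has (fun C => all (fun l => tneg l \in L) (items C)) (items cls).

Definition FNegMem (l L : fn) : fn := FCall FMem [:: FNeg l; L].

Definition FFalsified : fn :=
  FNot (FHas (FVar 0) (FNot (FNegMem (FVar 0) (FVar 2)))).

Definition FBad : fn :=
  FOr (FHas (FVar 0) (FNegMem (FVar 0) (FVar 1))) (FHas (FVar 1) FFalsified).

Lemma flat_tneg l : flat l -> flat (tneg l).
Proof.
rewrite /flat /tneg; case: l => //= a b.
by rewrite !geq_max => /andP[-> _]; case: ifP.
Qed.

Lemma run_FNegMem l L t x : flat (run l x) -> run L x = of_seq t ->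
  all flat t -> run (FNegMem l L) x = enc_bool (tneg (run l x) \in t).
Proof.
move=> fl rL ft; rewrite run_FCall [map _ _]/= rL.
rewrite -[Node (left_tree _) _]/(tneg (run l x)).
rewrite run_FMem ?of_seqK //; exact: flat_tneg.
Qed.

Lemma run_FNot f x b : run f x = enc_bool b ->
  run (FNot f) x = enc_bool (~~ b).
Proof. by move=> rf; rewrite /= rf; case: b {rf}. Qed.

Lemma run_FFalsified L C x : all flat L -> all flat (items C) ->
  run FFalsified (Node C (Node (of_seq L) x)) =
  enc_bool (all (fun l => tneg l \in L) (items C)).
Proof.
move=> fL /allP fC; rewrite -[all _ _]negbK; apply: run_FNot.
rewrite run_FHas -has_predC; congr enc_bool; apply: eq_in_has => l lC.
rewrite (run_FNot (b := tneg l \in L)) ?is_node_enc_bool //.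
by rewrite (run_FNegMem (t := L)) //; exact: fC.
Qed.

Lemma run_FBad L cls x : all flat L ->
  all (fun C => all flat (items C)) (items cls) ->
  run FBad (Node (of_seq L) (Node cls x)) = enc_bool (bad L cls).
Proof.
move=> fL /allP fcls; set y := Node _ _.
rewrite -[LHS]/(if is_node (run (FHas (FVar 0) (FNegMem (FVar 0) (FVar 1))) y)
  then enc_bool true else run (FHas (FVar 1) FFalsified) y).
rewrite !run_FHas is_node_enc_bool of_seqK /bad.
rewrite (eq_in_has (a2 := fun l => tneg l \in L)); last first.
  move=> l lL; rewrite (run_FNegMem (t := L)) ?is_node_enc_bool //.
  exact: (allP fL).
case: ifP => // _; congr enc_bool; apply: eq_in_has => C Ccls.
by rewrite run_FFalsified ?is_node_enc_bool //; exact: fcls.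
Qed.

Lemma poly_FNegMem l L : poly l -> poly L -> poly (FNegMem l L).
Proof. by move=> pl pL; rewrite /FNegMem /FNeg; poly_tac. Qed.

Lemma poly_FBad : poly FBad.
Proof.
have := poly_FNegMem => pN; rewrite /FBad /FFalsified.
by poly_tac; apply: pN; poly_tac.
Qed.
#[local] Hint Resolve poly_FItems poly_FBad : poly.

(* The neighbours of a triple vertex leave it just the three colours of its
   items, and these get used up exactly when the items are all realised. *)
Definition tri (P : seq tree) (x y z : tree) : tree :=
  Node Leaf (of_seq [:: item_g x, item_g y, item_g z
    & [seq q <- P | q \notin [:: item_p x; item_p y; item_p z]]]).

Definition lits3 (x y z : tree) : seq tree :=
  catrev (items (item_lits x))
    (catrev (items (item_lits y)) (items (item_lits z))).

Definition triV (I0 I1 I2 P : seq tree) (cls : tree) : seq tree :=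
  flatten [seq flatten [seq flatten [seq
    if bad (lits3 x y z) cls then [:: tri P x y z] else [::]
    | z <- I2] | y <- I1] | x <- I0].

Definition FItemG (x : fn) : fn := FLeft x.
Definition FItemP (x : fn) : fn := FLeft (FRight x).
Definition FItemLits (x : fn) : fn := FRight (FRight x).

Definition FAvoid3 : fn :=
  FFor (FVar 6) (FIf (FCall FMem [:: FVar 0;
      FList [:: FItemP (FVar 3); FItemP (FVar 2); FItemP (FVar 1)]])
    FLeaf (FList [:: FVar 0])).

Definition FTri : fn :=
  FIf (FCall FBad [:: FRevCat (FItemLits (FVar 2))
        (FRevCat (FItemLits (FVar 1)) (FItemLits (FVar 0))); FVar 7])
    (FList [:: FNode FLeaf
      (FNode (FItemG (FVar 2)) (FNode (FItemG (FVar 1))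
        (FNode (FItemG (FVar 0)) FAvoid3)))])
    FLeaf.

(** Every [FFor] pushes its element, so the item lists sit at positions 0, 2 and 4 when their turn
    comes, and the palette and the clauses at 6 and 7 in the innermost body. *)
Definition FTriV : fn := FFor (FVar 0) (FFor (FVar 2) (FFor (FVar 4) FTri)).

Definition flat_item (x : tree) : bool :=
  flat (item_p x) && all flat (items (item_lits x)).

Lemma run_FTriV I0 I1 I2 P cls x : all flat_item (I0 ++ I1 ++ I2) ->
  all flat P -> all (fun C => all flat (items C)) (items cls) ->
  run FTriV (Node (of_seq I0) (Node (of_seq I1) (Node (of_seq I2)
    (Node (of_seq P) (Node cls x))))) = of_seq (triV I0 I1 I2 P cls).
Proof.
rewrite !all_cat => /and3P[/allP fI0 /allP fI1 /allP fI2] /allP fP fcls.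
apply: run_FForE => // u uI; apply: run_FForE => // v vI.
apply: run_FForE => // w wI.
have /andP[pu lu] := fI0 u uI; have /andP[pv lv] := fI1 v vI.
have /andP[pw lw] := fI2 w wI.
set y := Node w _.
have avE : run FAvoid3 y =
    of_seq [seq q <- P | q \notin [:: item_p u; item_p v; item_p w]].
  apply: run_filter => // q qP.
  rewrite [~~ _]/= negbK run_FCall.
  rewrite -[of_seq _]/(of_seq [:: q; of_seq [:: item_p u; item_p v; item_p w]]).
  by rewrite (run_FMem (l := of_seq [:: _; _; _])) //=;
    [exact: fP|rewrite pu pv pw].
rewrite -[LHS]/(if is_node (run FBad (Node (run (FRevCat (FItemLits (FVar 2))
        (FRevCat (FItemLits (FVar 1)) (FItemLits (FVar 0)))) y)
      (Node cls Leaf)))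
  then of_seq [:: Node Leaf (Node (item_g u) (Node (item_g v)
    (Node (item_g w) (run FAvoid3 y))))] else Leaf).
rewrite avE !run_FRevCat of_seqK -/(lits3 u v w) run_FBad //.
  by rewrite is_node_enc_bool; case: ifP.
by rewrite /lits3 !catrevE !all_cat !all_rev lu lv lw.
Qed.

Lemma poly_FTriV : poly FTriV.
Proof.
by rewrite /FTriV /FTri /FAvoid3 /FItemG /FItemP /FItemLits; poly_tac.
Qed.
#[local] Hint Resolve poly_FTriV : poly.

(** * Adjacency and the encoded output *)

Definition vadj (u v : tree) : bool :=
  (left_tree u \in items (right_tree v)) ||
  (left_tree v \in items (right_tree u)).

Definition FAdj : fn :=
  FOr (FCall FMem [:: FLeft (FVar 1); FRight (FVar 0)])
    (FCall FMem [:: FLeft (FVar 0); FRight (FVar 1)]).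

Definition flat_vertex (u : tree) : bool :=
  flat (left_tree u) && all flat (items (right_tree u)).

Lemma run_FAdj u v x : flat_vertex u -> flat_vertex v ->
  run FAdj (Node v (Node u x)) = enc_bool (vadj u v).
Proof.
move=> /andP[u1 u2] /andP[v1 v2].
rewrite -[LHS]/(if is_node (run FMem (of_seq [:: left_tree u; right_tree v]))
  then enc_bool true else run FMem (of_seq [:: left_tree v; right_tree u])).
by rewrite !run_FMem // is_node_enc_bool /vadj; case: ifP.
Qed.

Definition FMatrix : fn :=
  FFor (FVar 0) (FList [:: FFor (FVar 1) (FList [:: FAdj])]).

Definition FCover : fn :=
  FFor (FVar 0) (FList [:: FIf (FLeft (FVar 0)) FTrue FLeaf]).

Definition FCount (l : fn) : fn := FFor l (FList [:: FLeaf]).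

Definition FOut : fn :=
  FNode FMatrix (FNode FCover (FNode (FCount (FVar 1)) (FCount (FVar 2)))).

Lemma run_FCount l x s : run l x = of_seq s ->
  run (FCount l) x = enc_nat (size s).
Proof.
move=> ls; rewrite /FCount (run_FForE1 (f := fun=> Leaf) ls) //.
by elim: s {ls} => //= _ s ->.
Qed.

Definition out (V U P : seq tree) : tree :=
  Node (of_seq [seq of_seq [seq enc_bool (vadj u v) | v <- V] | u <- V])
    (Node (of_seq [seq enc_bool (is_node (left_tree u)) | u <- V])
      (Node (enc_nat (size U)) (enc_nat (size P)))).

Lemma run_FOut V U P : all flat_vertex V ->
  run FOut (of_seq [:: of_seq V; of_seq U; of_seq P]) = out V U P.
Proof.
move=> /allP fV; set y := of_seq _.
rewrite -[LHS]/(Node (run FMatrix y) (Node (run FCover y)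
  (Node (run (FCount (FVar 1)) y) (run (FCount (FVar 2)) y)))).
rewrite (@run_FCount (FVar 1) y U) // (@run_FCount (FVar 2) y P) //.
congr (Node _ (Node _ _)).
  apply: run_FForE1 => // u uV.
  rewrite run_FList; congr (of_seq [:: _]).
  apply: run_FForE1 => // v vV.
  rewrite -[LHS]/(of_seq [:: run FAdj (Node v (Node u y))]).
  by rewrite run_FAdj ?fV.
by apply: run_FForE1 => // u uV; rewrite /=; case: (left_tree u).
Qed.

Lemma poly_FOut : poly FOut.
Proof. by rewrite /FOut /FMatrix /FCover /FCount /FAdj; poly_tac. Qed.
#[local] Hint Resolve poly_FOut : poly.

(** The stages act as nested let bindings: each one computes shared intermediate results and hands
    them to the next as its environment. *)
Definition FReduce4 : fn :=
  FCall FOut [:: FRevCat (FVar 0) (FVar 1); FVar 1; FVar 2].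

Definition FReduce3 : fn :=
  FCall FReduce4
    [:: FCall FTriV [:: FVar 1; FVar 2; FVar 3; FVar 0; FVar 5];
        FRevCat (FCall FGrpV [:: FVar 4; FVar 0]) (FCall FPalV [:: FVar 0]);
        FVar 0].

Definition FReduce2 : fn :=
  FCall FReduce3
    [:: FCall FPal [:: FVar 0];
        FCall FItems [:: FLeaf; FVar 1; FVar 0];
        FCall FItems [:: FTrue; FVar 1; FVar 0];
        FCall FItems [:: FNode FLeaf FTrue; FVar 1; FVar 0];
        FVar 1; FVar 2].

Definition FReduce1 : fn :=
  FCall FReduce2
    [:: FCall FWords [:: FVar 0];
        FCall FGroups [:: FVar 0; FCall FLog [:: FVar 0]];
        FVar 1].

Definition FReduce : fn := FCall FReduce1 [:: FLeft FId; FRight FId].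

Lemma poly_FReduce : poly FReduce.
Proof.
rewrite /FReduce /FReduce1 /FReduce2 /FReduce3 /FReduce4.
by poly_tac.
Qed.

Definition enc_words (n : nat) : seq tree := map enc_word (words (log4 n)).
Definition enc_groups (n : nat) : seq tree := map enc_group (groups n).
Definition palette (n : nat) : seq tree := pal (enc_words n).

Definition cover_vertices (n : nat) : seq tree :=
  catrev (grpV (enc_groups n) (palette n)) (palV (palette n)).

Definition triples (n : nat) (cls : tree) : seq tree :=
  let I s := item_list s (enc_groups n) (enc_words n) in
  triV (I (enc_nat 0)) (I (enc_nat 1)) (I (enc_nat 2)) (palette n) cls.

Definition vertices (n : nat) (cls : tree) : seq tree :=
  catrev (triples n cls) (cover_vertices n).

Definition flat_cnf (cls : tree) : bool :=
  all (fun C => all flat (items C)) (items cls).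

Lemma rank_tag s : s \in tags -> rank s <= 1.
Proof. by rewrite !inE => /or3P[] /eqP ->. Qed.

Lemma rank_enc_word w : rank (enc_word w) <= 2.
Proof.
apply: rank_of_seq; apply/allP => _ /mapP[b _ ->].
exact: rank_enc_bool.
Qed.

Lemma rank_enc_group g : rank (enc_group g) <= 2.
Proof.
apply: rank_of_seq; apply/allP => _ /mapP[i _ ->].
exact: rank_enc_nat.
Qed.

Lemma flat_pid s w : s \in tags -> rank w <= 2 -> flat (pid s w).
Proof. move=> /rank_tag /= s1 w2; rewrite /flat /=; lia. Qed.

Lemma flat_gid s g : s \in tags -> rank g <= 2 -> flat (gid s g).
Proof. move=> /rank_tag /= s1 w2; rewrite /flat /=; lia. Qed.

Lemma flat_palette n : all flat (palette n).
Proof.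
apply/allP => _ /allpairsP[[s w] [/= sT /mapP[v _ ->] ->]].
exact/flat_pid/rank_enc_word.
Qed.

Lemma mem_lits g w l :
  l \in lits (enc_group g) (enc_word w) ->
  exists i b, l = Node (enc_nat i) (enc_bool b).
Proof.
rewrite /lits mem_rev !of_seqK => /mapP[[a c] ac ->] /=.
have /mapP[i _ ->] : a \in map enc_nat g.
  by move: ac; elim: (g) (w) => [|j u IH] [|d v] //=;
    rewrite !inE => /orP[/eqP[-> _]|/IH ->]; rewrite ?eqxx ?orbT.
have /mapP[b _ ->] : c \in map enc_bool w; last by exists i, b.
by move: ac; elim: (g) (w) => [|j u IH] [|d v] //=;
  rewrite !inE => /orP[/eqP[_ ->]|/IH ->]; rewrite ?eqxx ?orbT.
Qed.

Lemma flat_item_list n s : s \in tags ->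
  all flat_item (item_list s (enc_groups n) (enc_words n)).
Proof.
move=> sT; apply/allP => _ /allpairsP[[g w] [/= /mapP[u _ ->] /mapP[v _ ->] ->]].
rewrite /flat_item flat_pid ?rank_enc_word //= of_seqK.
apply/allP => l /mem_lits[i [b ->]]; rewrite /flat /=.
have := rank_enc_nat i; have := rank_enc_bool b; lia.
Qed.

Lemma flat_cover n : all flat_vertex (cover_vertices n).
Proof.
have fP := flat_palette n.
rewrite /cover_vertices catrevE all_cat all_rev; apply/andP; split.
  apply/allP => _ /allpairsP[[s g] [/= sT /mapP[u _ ->] ->]].
  rewrite /flat_vertex flat_gid ?rank_enc_group //= of_seqK.
  by apply/allP => q; rewrite mem_filter => /andP[_] /(allP fP).
apply/allP => _ /mapP[p pP ->].
rewrite /flat_vertex [left_tree _]/= (allP fP p pP) /= of_seqK.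
by apply/allP => q; rewrite mem_filter => /andP[_] /(allP fP).
Qed.

Lemma mem_triV I0 I1 I2 P cls t :
  t \in triV I0 I1 I2 P cls <-> exists x y z,
    [/\ x \in I0, y \in I1, z \in I2, bad (lits3 x y z) cls & t = tri P x y z].
Proof.
split=> [/flatten_mapP[x xI /flatten_mapP[y yI /flatten_mapP[z zI]]]|].
  by case: ifP => // b; rewrite inE => /eqP ->; exists x, y, z.
case=> x [y [z [xI yI zI b ->]]]; apply/flatten_mapP; exists x => //.
apply/flatten_mapP; exists y => //; apply/flatten_mapP; exists z => //.
by rewrite b inE.
Qed.

Lemma flat_vertices n cls : all flat_vertex (vertices n cls).
Proof.
rewrite /vertices catrevE all_cat all_rev flat_cover andbT.
apply/allP => t /mem_triV[x [y [z [xI yI zI _ ->]]]].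
rewrite /flat_vertex /= of_seqK.
have fI s u : s \in tags -> u \in item_list s (enc_groups n) (enc_words n) ->
    flat (item_g u).
  move=> sT /allpairsP[[g w] [/= /mapP[v _ ->] _ ->]].
  by rewrite flat_gid ?rank_enc_group.
apply/and4P; split.
- exact: fI xI.
- exact: fI yI.
- exact: fI zI.
by apply/allP => q; rewrite mem_filter => /andP[_] /(allP (flat_palette n)).
Qed.

(** Flatness keeps every equality test within rank 3, the range in which [FEq 3] is correct. *)
Lemma run_FReduce n cls : flat_cnf cls ->
  run FReduce (Node (enc_nat n) cls) =
  out (vertices n cls) (cover_vertices n) (palette n).
Proof.
move=> fcls; set W := enc_words n; set G := enc_groups n; set P := palette n.
have -> : run FReduce (Node (enc_nat n) cls) =
    run FReduce2 (of_seq [:: of_seq W; of_seq G; cls]).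
  rewrite /FReduce run_FCall.
  rewrite -[map _ _]/[:: enc_nat n; cls] /FReduce1 run_FCall; congr run.
  rewrite -[map _ _]/[:: run FWords (of_seq [:: enc_nat n]); run FGroups
    (of_seq [:: enc_nat n; run FLog (of_seq [:: enc_nat n])]); cls].
  by rewrite run_FWords run_FLog size_items_enc_nat run_FGroups.
have gw g w : g \in G -> w \in W -> size (items g) <= size (items w).
  move=> /mapP[u uG ->] /mapP[v]; rewrite mem_words => /eqP vs ->.
  rewrite !of_seqK !size_map vs; have [/allP sG _] := groups_size n.
  exact: sG.
rewrite /FReduce2 run_FCall.
rewrite -[map _ _]/[:: run FPal (of_seq [:: of_seq W]);
  run FItems (of_seq [:: enc_nat 0; of_seq G; of_seq W]);
  run FItems (of_seq [:: enc_nat 1; of_seq G; of_seq W]);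
  run FItems (of_seq [:: enc_nat 2; of_seq G; of_seq W]); of_seq G; cls].
rewrite run_FPal !run_FItems // -/P.
set I := fun s => item_list s G W.
set y := of_seq [:: of_seq P; of_seq (I (enc_nat 0)); of_seq (I (enc_nat 1));
  of_seq (I (enc_nat 2)); of_seq G; cls].
have coverE : run (FRevCat (FCall FGrpV [:: FVar 4; FVar 0])
    (FCall FPalV [:: FVar 0])) y = of_seq (cover_vertices n).
  rewrite run_FRevCat !run_FCall.
  rewrite -[of_seq (map _ _)]/(of_seq [:: of_seq G; of_seq P]).
  rewrite -[of_seq (map _ [:: _])]/(of_seq [:: of_seq P]).
  by rewrite run_FGrpV ?run_FPalV ?flat_palette // !of_seqK.
have -> : run FReduce3 y = run FReduce4 (of_seq [::
    run FTriV (of_seq [:: of_seq (I (enc_nat 0)); of_seq (I (enc_nat 1));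
      of_seq (I (enc_nat 2)); of_seq P; cls]);
    run (FRevCat (FCall FGrpV [:: FVar 4; FVar 0])
      (FCall FPalV [:: FVar 0])) y; of_seq P]).
  by rewrite /FReduce3 run_FCall.
rewrite coverE run_FTriV ?flat_palette //; last first.
  by rewrite !all_cat !flat_item_list.
rewrite -/(triples n cls); set z := of_seq _.
have -> : run FReduce4 z = run FOut (of_seq [:: run (FRevCat (FVar 0) (FVar 1)) z;
    of_seq (cover_vertices n); of_seq P]).
  by rewrite /FReduce4 run_FCall.
rewrite run_FRevCat !of_seqK -/(vertices n cls) run_FOut //.
exact: flat_vertices.
Qed.

(** * Correctness of the reduction *)

Definition lit (i : nat) (b : bool) : tree := Node (enc_nat i) (enc_bool b).

Lemma tneg_lit i b : tneg (lit i b) = lit i (~~ b).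
Proof. by rewrite /tneg /= is_node_enc_bool; case: b. Qed.

Lemma enc_nat_inj : injective enc_nat.
Proof.
by apply: (can_inj (g := fun t => size (items t))) => n; exact: size_items_enc_nat.
Qed.

Lemma lits_total g w i : i \in g -> size g <= size w ->
  exists b, lit i b \in lits (enc_group g) (enc_word w).
Proof.
move=> ig gw; suff [b bl] : exists b, (enc_nat i, enc_bool b) \in
    zip (map enc_nat g) (map enc_bool w).
  by exists b; rewrite /lits mem_rev !of_seqK; apply/mapP; eexists; first exact: bl.
elim: g w ig gw => [|j g IH] [|b w] //=; rewrite inE ltnS => /orP[/eqP ->|ig] gw.
  by exists b; rewrite mem_head.
by have [c ic] := IH w ig gw; exists c; rewrite inE ic orbT.
Qed.

Lemma lits_true (a : nat -> bool) g b : size g <= b -> exists2 w,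
  w \in words b & forall l, l \in lits (enc_group g) (enc_word w) ->
    exists2 i, i \in g & l = lit i (a i).
Proof.
(* The padding only adjusts the length; [zip] never reaches it. *)
move=> gb; exists (map a g ++ nseq (b - size g) false).
  by rewrite mem_words size_cat size_map size_nseq subnKC.
move=> l; rewrite /lits mem_rev !of_seqK => /mapP[p pz ->].
elim: g {b gb}(b - size g) pz => [|i g IH] m /=; first by case: m.
rewrite inE => /orP[/eqP ->|/IH[j jg jE]]; first by exists i; rewrite ?mem_head.
by exists j; rewrite ?inE ?jg ?orbT.
Qed.

Lemma mem_lits3 x y z l : (l \in lits3 x y z) =
  [|| l \in items (item_lits x), l \in items (item_lits y)
    | l \in items (item_lits z)].
Proof. by rewrite /lits3 !catrevE !mem_cat !mem_rev. Qed.

Definition palv (n : nat) (p : tree) : tree :=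
  Node p (of_seq [seq q <- palette n | q != p]).

Definition grpv (n : nat) (s g : tree) : tree :=
  Node (gid s g) (of_seq [seq q <- palette n | tag q != s]).

Lemma mem_vertices n cls u : u \in vertices n cls <->
  [\/ exists2 p, p \in palette n & u = palv n p,
      exists s g, [/\ s \in tags, g \in enc_groups n & u = grpv n s g]
    | u \in triples n cls].
Proof.
rewrite /vertices /cover_vertices !catrevE !mem_cat !mem_rev; split.
  case/or3P=> [ut|/allpairsP[[s g] [sT gG ->]]|/mapP[p pP ->]].
  - by apply: Or33.
  - by apply: Or32; exists s, g.
  - by apply: Or31; exists p.
case=> [[p pP ->]|[s [g [sT gG ->]]]|->]; last by [].
- by apply/or3P/Or33/mapP; exists p.
- by apply/or3P/Or32/allpairsP; exists (s, g).
Qed.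

Lemma uniq_palette n : uniq (palette n).
Proof.
apply: allpairs_uniq => //; first by rewrite (map_inj_uniq enc_word_inj) uniq_words.
by move=> [s w] [s' w'] _ _ /= [-> ->].
Qed.

Lemma size_palette n : size (palette n) = 3 * 2 ^ log4 n.
Proof. by rewrite size_allpairs size_map size_words. Qed.

Lemma mem_groups n i : i < n -> exists2 g, g \in groups n & i \in g.
Proof.
move=> ltn; have : i \in flatten (groups n) by rewrite mem_fill ltn.
by case/flattenP => g gG ig; exists g.
Qed.

(** Colouring trees rather than positions gives repeated entries the same colour, which is harmless
    because no vertex of the reduction lists its own identifier. *)
Definition list_colorable (V : seq tree) (l : nat) : Prop :=
  exists col : tree -> nat, (forall u, u \in V -> col u < l) /\
    forall u v, u \in V -> v \in V -> vadj u v -> col u <> col v.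

Definition enc_cnf (n : nat) (phi : cnf n) : tree :=
  enc_seq (enc_seq (@enc_literal _)) phi.

Lemma items_enc_cnf n (phi : cnf n) :
  items (enc_cnf phi) = [seq of_seq (map (@enc_literal n) C) | C <- phi].
Proof.
rewrite /enc_cnf enc_seqE of_seqK; apply: eq_map => C; exact: enc_seqE.
Qed.

(** * From a colouring to a satisfying assignment *)

Lemma enc_nat_tags k : k < 3 -> enc_nat k \in tags.
Proof. by case: k => [|[|[|]]]. Qed.

Lemma items_tri P x y z : items (right_tree (tri P x y z)) =
  [:: item_g x, item_g y, item_g z
    & [seq q <- P | q \notin [:: item_p x; item_p y; item_p z]]].
Proof. exact: of_seqK. Qed.

Lemma colorable_sat n (phi : cnf n) :
  all (fun C => size C <= 3) phi ->
  list_colorable (vertices n (enc_cnf phi)) (size (palette n)) ->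
  exists a : {ffun 'I_n -> bool}, satisfies a phi.
Proof.
set V := vertices n _; set P := palette n => width [col [col_lt col_ne]].
have PV p : p \in P -> palv n p \in V.
  by move=> pP; apply/mem_vertices/Or31; exists p.
have GV s g : s \in tags -> g \in enc_groups n -> grpv n s g \in V.
  by move=> sT gG; apply/mem_vertices/Or32; exists s, g.
(* The palette is a clique with as many vertices as there are colours, so every colour occurs on
   it. *)
have surj c : c < size P -> exists2 p, p \in P & c = col (palv n p).
  move=> cP; have [|||_ eqi] :=
    @uniq_min_size _ (map (col \o palv n) P) (iota 0 (size P)).
  - rewrite map_inj_in_uniq ?uniq_palette // => p q pP qP /= pq.
    apply/eqP; apply/negPn/negP => npq.
    apply: (col_ne (palv n p) (palv n q)); rewrite ?PV //.
    by rewrite /vadj [right_tree _]/= of_seqK mem_filter npq pP.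
  - by move=> _ /mapP[p pP ->]; rewrite mem_iota add0n /= col_lt ?PV.
  - by rewrite size_map size_iota.
  have : c \in iota 0 (size P) by rewrite mem_iota.
  by rewrite -eqi => /mapP[p pP ->]; exists p.
(* The colour of a group vertex occurs on the palette, and the palettes of the other two copies are
   adjacent to that vertex. *)
have pickw s g : s \in tags -> g \in enc_groups n -> exists2 w,
    w \in enc_words n & col (grpv n s g) = col (palv n (pid s w)).
  move=> sT gG; have [p pP gp] := surj _ (col_lt _ (GV s g sT gG)).
  have [ts|ts] := eqVneq (tag p) s; last first.
    case: (col_ne (grpv n s g) (palv n p)); rewrite ?GV ?PV //.
    by rewrite /vadj [right_tree (grpv _ _ _)]/= of_seqK mem_filter ts pP orbT.
  move: pP ts gp => /allpairsP[[s' w] [/= _ wW ->]]; rewrite /tag /= => -> gp.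
  by exists w.
pose fits s g w := col (grpv n s g) == col (palv n (pid s w)).
pose h s g := nth Leaf (enc_words n) (find (fits s g) (enc_words n)).
have hW s g : s \in tags -> g \in enc_groups n -> h s g \in enc_words n.
  move=> sT gG; apply: mem_nth; rewrite -has_find.
  by have [w wW gw] := pickw s g sT gG; apply/hasP; exists w => //; apply/eqP.
have hcol s g : s \in tags -> g \in enc_groups n ->
    col (grpv n s g) = col (palv n (pid s (h s g))).
  move=> sT gG; apply/eqP; apply: (nth_find Leaf (a := fits s g)).
  by have [w wW gw] := pickw s g sT gG; apply/hasP; exists w => //; apply/eqP.
pose it (g : nat -> tree) k := item (enc_nat k) (g k) (h (enc_nat k) (g k)).
pose L g := lits3 (it g 0) (it g 1) (it g 2).
have inL g k l : k < 3 -> l \in lits (g k) (h (enc_nat k) (g k)) -> l \in L g.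
  case: k => [|[|[|//]]] _ lg; rewrite /L mem_lits3 /item_lits /= !of_seqK lg;
  by rewrite ?orbT.
(* A bad triple of chosen items would have a vertex [t], with the colour of some palette vertex [p].
   Either [p] is adjacent to [t], or [p] is the word of one of the three items and shares its colour
   with a group vertex adjacent to [t]. *)
have good g : (forall k, k < 3 -> g k \in enc_groups n) ->
    ~~ bad (L g) (enc_cnf phi).
  move=> gG; apply/negP => badL.
  pose t := tri P (it g 0) (it g 1) (it g 2).
  have itG k : k < 3 ->
      it g k \in item_list (enc_nat k) (enc_groups n) (enc_words n).
    move=> k3; apply/allpairsP; exists (g k, h (enc_nat k) (g k)).
    by split=> //=; [exact: gG|apply: hW; [exact: enc_nat_tags|exact: gG]].
  have tV : t \in V.
    apply/mem_vertices/Or33/mem_triV.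
    by exists (it g 0), (it g 1), (it g 2); split=> //; exact: itG.
  have [p pP tp] := surj _ (col_lt t tV).
  have nG k : k < 3 -> col (grpv n (enc_nat k) (g k)) <> col t.
    move=> k3; apply: col_ne => //.
      by apply: GV; [exact: enc_nat_tags|exact: gG].
    rewrite /vadj items_tri.
    by case: k k3 => [|[|[|//]]] _; rewrite !inE eqxx ?orbT.
  have [pin|pnin] := boolP (p \in [:: item_p (it g 0); item_p (it g 1);
      item_p (it g 2)]).
    have [k k3 pk] : exists2 k, k < 3 & p = pid (enc_nat k) (h (enc_nat k) (g k)).
      by move: pin; rewrite !inE => /or3P[] /eqP ->; [exists 0|exists 1|exists 2].
    by apply: (nG k k3); rewrite tp pk; apply: hcol; [exact: enc_nat_tags|exact: gG].
  case: (col_ne (palv n p) t) => //; first exact: PV.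
  by rewrite /vadj items_tri 3!in_cons mem_filter pnin /P pP !orbT.
have consistent g l : (forall k, k < 3 -> g k \in enc_groups n) ->
    l \in L g -> tneg l \notin L g.
  move=> gG lL; apply/negP => nlL; have := good g gG.
  by rewrite /bad negb_or => /andP[/hasP[]]; exists l.
pose G i := enc_group (nth [::] (groups n) (find (fun g => i \in g) (groups n))).
have hasG i : i < n -> has (fun g => i \in g) (groups n).
  by move=> /mem_groups[g gG ig]; apply/hasP; exists g.
have GG i : i < n -> G i \in enc_groups n.
  by move=> /hasG; rewrite has_find => lt; apply: map_f; exact: mem_nth.
have total i k : i < n -> k < 3 ->
    exists b, lit i b \in lits (G i) (h (enc_nat k) (G i)).
  move=> ltn k3; have := hW _ _ (enc_nat_tags k3) (GG i ltn).
  move=> /mapP[w]; rewrite mem_words => /eqP sw ->; apply: lits_total.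
    exact: (nth_find [::] (hasG i ltn)).
  rewrite sw; have [/allP sG _] := groups_size n; apply: sG.
  by apply: mem_nth; rewrite -has_find hasG.
pose a i := lit i true \in lits (G i) (h (enc_nat 0) (G i)).
(* The copies agree on variable [i]: otherwise the triple taking the group of [i] in all three
   copies would contradict itself. *)
have aP i k : i < n -> k < 3 -> lit i (a i) \in lits (G i) (h (enc_nat k) (G i)).
  move=> ltn k3; have [b0 i0] := total i 0 ltn isT.
  have [b ik] := total i k ltn k3.
  have cons c : lit i c \in L (fun=> G i) -> lit i (~~ c) \notin L (fun=> G i).
    by rewrite -tneg_lit; apply: consistent => ? _; exact: GG.
  have ik' := @inL (fun=> G i) k _ k3 ik.
  have i0' := @inL (fun=> G i) 0 _ isT i0.
  suff -> : a i = b by [].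
  have := cons b ik'; have := cons b0 i0'; rewrite /a.
  have [/(@inL (fun=> G i) 0 _ isT) t0|f0] := boolP (lit i true \in _).
    by case: b ik ik' => // _ _ _; rewrite -[~~ false]/true t0.
  case: b0 i0 i0' => [i0|_ i0']; first by rewrite i0 in f0.
  by case: b ik ik' => // _ _ _; rewrite -[~~ true]/false i0'.
exists [ffun i : 'I_n => a i]; apply/allP => C Cphi; apply/negPn/negP.
rewrite -all_predC => /allP Cfalse.
pose gd := enc_group (nth [::] (groups n) 0).
(* Copy [k] takes the group of the variable of literal number [k], and [gd] replaces missing
   literals. If [C] were false under [a], this triple would be bad. *)
pose g k := if drop k C is l :: _ then G (nat_of_ord l.1) else gd.
have gG k : k < 3 -> g k \in enc_groups n.
  move=> _; rewrite /g; case: (drop k C) => [|l _]; last exact: GG.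
  by apply: map_f; apply: mem_nth; exact: groups_gt0.
have := good g gG; rewrite /bad negb_or => /andP[_ /hasP[]].
exists (of_seq (map (@enc_literal n) C)).
  by rewrite items_enc_cnf; exact: map_f.
rewrite of_seqK; apply/allP => _ /mapP[l lC ->].
have k3 : index l C < 3.
  by apply: leq_trans (allP width C Cphi); rewrite index_mem.
have gk : g (index l C) = G (nat_of_ord l.1).
  by rewrite /g (drop_nth l) ?index_mem // nth_index.
have := Cfalse l lC; rewrite /= ffunE => al.
have -> : tneg (enc_literal l) = lit l.1 (a l.1).
  rewrite -[enc_literal l]/(lit l.1 l.2) tneg_lit; congr lit.
  by move: al; case: (a _); case: (l.2).
apply: (inL g (index l C)) => //.
by rewrite gk; exact: aP.
Qed.

(** * From a satisfying assignment to a colouring *)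

Lemma mem_palette n p : reflect
  (exists s w, [/\ s \in tags, w \in enc_words n & p = pid s w])
  (p \in palette n).
Proof.
apply: (iffP idP) => [/allpairsP[[s w] [sT wW ->]]|[s [w [sT wW ->]]]].
  by exists s, w.
by apply/allpairsP; exists (s, w).
Qed.

Lemma index_inj (T : eqType) (s : seq T) x y :
  x \in s -> y \in s -> index x s = index y s -> x = y.
Proof. by move=> xs ys e; rewrite -(nth_index x xs) e nth_index. Qed.

Lemma sat_colorable n (phi : cnf n) (a : {ffun 'I_n -> bool}) :
  satisfies a phi ->
  list_colorable (vertices n (enc_cnf phi)) (size (palette n)).
Proof.
set V := vertices n _; set P := palette n => sat.
(* Groups hold plain natural numbers, hence the extension of [a] by [false]. *)
pose a' i := if insub i is Some j then a j else false.
have a'E (i : 'I_n) : a' i = a i by rewrite /a' valK.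
pose val l := a' (size (items (left_tree l))) == is_node (right_tree l).
have val_neg l : val (tneg l) = ~~ val l.
  by rewrite /val /=; case: (a' _); case: (is_node (right_tree l)).
have val_lit i b : val (lit i b) = (a' i == b).
  by rewrite /val /= size_items_enc_nat is_node_enc_bool.
pose fits t w := all val (lits t w).
(* Surplus bits may leave several words that agree with [a] on the group; the first one is taken,
   the same in all three copies. *)
pose wf t := nth Leaf (enc_words n) (find (fits t) (enc_words n)).
have has_fits t : t \in enc_groups n -> has (fits t) (enc_words n).
  move=> /mapP[g gG ->]; have [/allP sG _] := groups_size n.
  have [w wb lw] := lits_true a' (sG g gG).
  apply/hasP; exists (enc_word w); first exact: map_f.
  by apply/allP => l /lw[i _ ->]; rewrite val_lit.
have wfW t : t \in enc_groups n -> wf t \in enc_words n.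
  by move=> /has_fits; rewrite has_find => /(mem_nth Leaf).
have wfP t : t \in enc_groups n -> all val (lits t (wf t)).
  by move=> /has_fits /(nth_find Leaf).
pose idcol q := if is_node (left_tree q)
  then index (pid (tag q) (wf (right_tree (right_tree q)))) P else index q P.
have idcol_pal p : p \in P -> idcol p = index p P.
  by move=> /mem_palette[s [w [_ _ ->]]].
pose free u c := c \notin map idcol (items (right_tree u)).
(* Triple vertices are independent, so each can take the first colour absent from its neighbours. *)
pose col u := if is_node (left_tree u) then idcol (left_tree u)
  else find (free u) (iota 0 (size P)).
have pidP s t : s \in tags -> t \in enc_groups n -> pid s (wf t) \in P.
  by move=> sT tG; apply/mem_palette; exists s, (wf t); rewrite wfW.
have freeP t : t \in triples n (enc_cnf phi) ->
    has (free t) (iota 0 (size P)).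
  move=> /mem_triV[x [y [z [/allpairsP[[g0 w0] [/= gG0 wW0 xE]]
    /allpairsP[[g1 w1] [/= gG1 wW1 yE]] /allpairsP[[g2 w2] [/= gG2 wW2 zE]]]]]].
  move=> badL tE.
  pose g k := nth Leaf [:: g0; g1; g2] k.
  pose w k := nth Leaf [:: w0; w1; w2] k.
  have gG k : k < 3 -> g k \in enc_groups n by case: k => [|[|[|]]].
  have wW k : k < 3 -> w k \in enc_words n by case: k => [|[|[|]]].
  (* If all three items agreed with [wf], their literals would all be true under [a], and neither
     reason for being bad could apply. *)
  have [k k3 wk] : exists2 k, k < 3 & w k != wf (g k).
    have [e0|] := eqVneq w0 (wf g0); last by exists 0.
    have [e1|] := eqVneq w1 (wf g1); last by exists 1.
    have [e2|] := eqVneq w2 (wf g2); last by exists 2.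
    have Lval l : l \in lits3 x y z -> val l.
      rewrite mem_lits3 xE yE zE /item_lits /= !of_seqK e0 e1 e2.
      by case/or3P; apply: (allP (wfP _ _)).
    move: badL; rewrite /bad => /orP[/hasP[l lL nlL]|/hasP[C]].
      by have := Lval _ nlL; rewrite val_neg Lval.
    rewrite items_enc_cnf => /mapP[D Dphi ->]; rewrite of_seqK => /allP Dbad.
    have /hasP[l lD /eqP al] := allP sat D Dphi.
    have /Lval := Dbad _ (map_f _ lD); rewrite val_neg => /negP[].
    by rewrite (val_lit l.1 l.2) a'E al.
  have pE : pid (enc_nat k) (w k) \in [:: item_p x; item_p y; item_p z].
    rewrite xE yE zE /w; case: (k) k3 => [|[|[|//]]] _; rewrite !inE eqxx ?orbT //.
  have pP : pid (enc_nat k) (w k) \in P.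
    by apply/mem_palette; exists (enc_nat k), (w k); rewrite enc_nat_tags ?wW.
  (* The palette colour of the deviating item is free: the triple vertex is not joined to that
     palette vertex, and among the group colours only that of copy [k] could clash, but its word
     differs. *)
  have ng j : j < 3 -> index (pid (enc_nat k) (w k)) P <>
      index (pid (enc_nat j) (wf (g j))) P.
    move=> j3 /index_inj; rewrite pP pidP ?enc_nat_tags ?gG // => /(_ isT isT).
    case=> /enc_nat_inj <- wkE; by rewrite wkE eqxx in wk.
  apply/hasP; exists (index (pid (enc_nat k) (w k)) P).
    by rewrite mem_iota index_mem.
  apply/negP; rewrite tE items_tri => /mapP[q]; rewrite !in_cons mem_filter.
  rewrite xE yE zE; case/or4P => [/eqP ->|/eqP ->|/eqP ->|/andP[qn qP]].
  - exact: (ng 0).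
  - exact: (ng 1).
  - exact: (ng 2).
  - rewrite idcol_pal // => /index_inj; rewrite pP qP => /(_ isT isT) qE.
    by move: qn; rewrite -qE -xE -yE -zE pE.
have mexP t : t \in triples n (enc_cnf phi) -> free t (col t) /\ col t < size P.
  move=> tT; have hf := freeP t tT.
  have -> : col t = find (free t) (iota 0 (size P)).
    by move: tT => /mem_triV[x [y [z [_ _ _ _ ->]]]].
  have lt : find (free t) (iota 0 (size P)) < size P.
    by move: hf; rewrite has_find size_iota.
  by split=> //; have := nth_find 0 hf; rewrite nth_iota.
have col_palv p : p \in P -> col (palv n p) = index p P.
  by move=> pP; rewrite -idcol_pal //; case/mem_palette: pP => s [w [_ _ ->]].
have col_grpv s g : col (grpv n s g) = index (pid s (wf g)) P by [].
have ne u v : u \in V -> v \in V -> left_tree u \in items (right_tree v) ->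
    col u <> col v.
  move=> uV vV uv.
  have node_id : left_tree u \in P \/ (exists s g, left_tree u = gid s g) ->
      col u = idcol (left_tree u).
    rewrite /col => -[/mem_palette[s [w [_ _ ->]]]|[s [g ->]]] //.
  case/mem_vertices: vV uv => [[p pP ->]|[s [g [sT gG ->]]]|vT].
  - rewrite of_seqK mem_filter => /andP[up uP].
    rewrite node_id; last by left.
    rewrite col_palv // idcol_pal // => /index_inj; rewrite uP pP.
    by move=> /(_ isT isT) e; rewrite e eqxx in up.
  - rewrite of_seqK mem_filter => /andP[us uP].
    rewrite node_id; last by left.
    rewrite col_grpv idcol_pal // => /index_inj; rewrite uP pidP //.
    by move=> /(_ isT isT) e; rewrite e /tag /= eqxx in us.
  - move=> uv; have [/negP fv _] := mexP v vT.
    rewrite node_id => [e|]; first by apply: fv; rewrite -e; exact: map_f.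
    move: vT uv => /mem_triV[x [y [z [/allpairsP[[g0 w0] [_ _ xE]]
      /allpairsP[[g1 w1] [_ _ yE]] /allpairsP[[g2 w2] [_ _ zE]] _ ->]]]].
    rewrite items_tri xE yE zE !in_cons mem_filter.
    by case/or4P => [/eqP ->|/eqP ->|/eqP ->|/andP[_ ?]];
      [right; eexists; eexists..|left].
exists col; split; last first.
  move=> u v uV vV /orP[|/(ne _ _ vV uV) h e]; first exact: ne.
  by apply: h.
move=> u /mem_vertices[[p pP ->]|[s [g [sT gG ->]]]|/mexP[] //].
  by rewrite col_palv // index_mem.
by rewrite col_grpv index_mem pidP.
Qed.

(** The first half puts one end of each edge into the cover, the second excludes loops. *)
Lemma vertices_nb n cls v q : v \in vertices n cls ->
  q \in items (right_tree v) -> is_node q /\ q <> left_tree v.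
Proof.
have Pnode p : p \in palette n -> is_node p.
  by move=> /mem_palette[s [w [_ _ ->]]].
case/mem_vertices => [[p pP ->]|[s [g [sT gG ->]]]|].
- by rewrite of_seqK mem_filter => /andP[/eqP qp /Pnode].
- rewrite of_seqK mem_filter => /andP[qs qP]; split; first exact: Pnode.
  by move=> qg; rewrite qg /tag /= eqxx in qs.
- move=> /mem_triV[x [y [z [/allpairsP[[g0 w0] [_ _ xE]]
    /allpairsP[[g1 w1] [_ _ yE]] /allpairsP[[g2 w2] [_ _ zE]] _ ->]]]].
  rewrite items_tri xE yE zE !in_cons mem_filter.
  by case/or4P => [/eqP ->|/eqP ->|/eqP ->|/andP[_ /Pnode]] //; case: (q).
Qed.

(** * The vertex list as an instance of Chromatic Number *)

Lemma vadj_sym u v : vadj u v = vadj v u.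
Proof. by rewrite /vadj orbC. Qed.

Lemma map_nth_ord T (F : tree -> T) (s : seq tree) :
  [seq F (nth Leaf s (nat_of_ord i)) | i <- enum 'I_(size s)] = map F s.
Proof.
rewrite (map_comp (fun k => F (nth Leaf s k)) (@nat_of_ord (size s))).
by rewrite val_enum_ord -[in RHS](mkseq_nth Leaf s) -map_comp.
Qed.

Section Instance.
Variables (n : nat) (cls : tree).
Let V := vertices n cls.
Let vtx (i : 'I_(size V)) : tree := nth Leaf V i.

Let vtxV i : vtx i \in V.
Proof. exact: mem_nth. Qed.

Definition reduction_adj (i j : 'I_(size V)) : bool := vadj (vtx i) (vtx j).

Lemma reduction_adj_sym : symmetric reduction_adj.
Proof. by move=> i j; exact: vadj_sym. Qed.

Lemma reduction_adj_irrefl : irreflexive reduction_adj.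
Proof.
by move=> i; apply/negbTE/negP; rewrite /reduction_adj /vadj orbb =>
  /(vertices_nb (vtxV i))[_].
Qed.

Definition reduction_graph : sgraph (size V) :=
  SGraph reduction_adj_sym reduction_adj_irrefl.

Definition reduction_cover : {set 'I_(size V)} :=
  [set i | is_node (left_tree (vtx i))].

Lemma reduction_coverP : vertex_cover reduction_graph reduction_cover.
Proof.
apply/forallP => i; apply/forallP => j; apply/implyP => /orP[] h;
  have [nd _] := vertices_nb (vtxV _) h; rewrite !inE /= nd ?orbT //.
Qed.

Lemma reduction_cover_size : #|reduction_cover| <= size (cover_vertices n).
Proof.
have -> : #|reduction_cover| = count (fun u => is_node (left_tree u)) V.
  rewrite -sum1_count -[V in RHS]map_id -map_nth_ord big_map sum1_count.
  by rewrite cardsE cardE size_filter -enumT; apply: eq_count.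
rewrite /V /vertices catrevE count_cat count_rev.
rewrite (_ : count _ (triples n cls) = 0) ?add0n ?count_size //.
apply/eqP; rewrite -leqn0 leqNgt -has_count -all_predC.
by apply/allP => u /mem_triV[x [y [z [_ _ _ _ ->]]]].
Qed.

Lemma palette_gt0 : 0 < size (palette n).
Proof. by rewrite size_palette muln_gt0 expn_gt0. Qed.

(** The parameter is the length of the list of cover vertices, thus a function of [n] alone; the
    number of colours is that of the palette vertices. *)
Definition reduction : chromatic_instance :=
  ChromaticInstance reduction_coverP reduction_cover_size palette_gt0.

Lemma enc_reduction :
  enc_chromatic reduction = out V (cover_vertices n) (palette n).
Proof.
rewrite /enc_chromatic /out /=; congr (Node _ (Node _ _)).
  rewrite /enc_graph enc_seqE -map_nth_ord; congr of_seq.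
  by apply: eq_map => i; rewrite enc_seqE -map_nth_ord.
by rewrite /enc_vset enc_seqE -map_nth_ord; congr of_seq; apply: eq_map => i;
  rewrite inE.
Qed.

Lemma colorable_list l : 0 < l ->
  colorable reduction_graph l <-> list_colorable V l.
Proof.
move=> l0; split=> [/existsP[f /forallP fP]|[col [col_lt col_ne]]].
  (* A tree gets the colour of its first position in [V]; the default 0 is met only outside [V]. *)
  exists (fun u => if insub (index u V) is Some i then f i : nat else 0).
  split=> [u uV|u v uV vV]; first by case: insub => [i|//]; exact: ltn_ord.
  have iu : index u V < size V by rewrite index_mem.
  have iv : index v V < size V by rewrite index_mem.
  move=> uv; rewrite (insubT (fun i => i < size V) iu).
  rewrite (insubT (fun i => i < size V) iv).
  move=> /val_inj e.
  have /forallP/(_ (Ordinal iv))/implyP := fP (Ordinal iu).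
  rewrite /= /reduction_adj /vtx /= !nth_index // => /(_ uv) /eqP[].
  exact: e.
apply/existsP; exists [ffun i => Ordinal (col_lt _ (vtxV i))].
apply/forallP => i; apply/forallP => j; apply/implyP => ij; rewrite !ffunE.
apply/eqP => -[]; exact: (col_ne _ _ (vtxV i) (vtxV j)).
Qed.
End Instance.

Lemma chromatic_number_le n (G : sgraph n) l :
  (chromatic_number G <= l) = colorable G l.
Proof.
rewrite /chromatic_number; case: ex_minnP => m mcol mmin.
apply/idP/idP => [ml|/mmin //].
case/existsP: mcol => f /forallP fP; apply/existsP.
exists [ffun i => widen_ord ml (f i)]; apply/forallP => x; apply/forallP => y.
apply/implyP => xy; rewrite !ffunE.
have /forallP/(_ y)/implyP/(_ xy) := fP x.
by apply: contra => /eqP /(congr1 val) /= h; apply/eqP/val_inj.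
Qed.

Definition reduce (x : sat3_instance) : chromatic_instance :=
  reduction (sat3_nvars x) (enc_cnf (sat3_cnf x)).

Lemma flat_enc_cnf n (phi : cnf n) : flat_cnf (enc_cnf phi).
Proof.
rewrite /flat_cnf items_enc_cnf; apply/allP => _ /mapP[C _ ->].
rewrite of_seqK; apply/allP => _ /mapP[l _ ->].
rewrite /flat -[rank _]/(maxn (rank (enc_nat l.1)).+1 (rank (enc_bool l.2))).
have := rank_enc_nat l.1; have := rank_enc_bool l.2; lia.
Qed.

Lemma run_FReduce_sat3 x : run FReduce (enc_sat3 x) = enc_chromatic (reduce x).
Proof. by rewrite run_FReduce ?flat_enc_cnf // enc_reduction. Qed.

Lemma reduce_correct x : chromatic_yes (reduce x) = satisfiable x.
Proof.
rewrite /chromatic_yes chromatic_number_le; apply/idP/existsP.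
  move=> /(colorable_list _ _ (palette_gt0 _)); apply: colorable_sat.
  exact: sat3_width.
case=> a /sat_colorable sc.
exact/(colorable_list _ _ (palette_gt0 _)).
Qed.

(** * Size of the reduction *)

Lemma tsize_enc_nat n : tsize (enc_nat n) = 2 * n + 1.
Proof. by elim: n => //= n ->; lia. Qed.

Lemma tsize_of_seq (s : seq tree) m : (forall t, t \in s -> tsize t <= m) ->
  tsize (of_seq s) <= size s * m.+1 + 1.
Proof.
elim: s => //= t s IH sm; have := sm t (mem_head _ _).
have : tsize (of_seq s) <= size s * m.+1 + 1.
  by apply: IH => u us; apply: sm; rewrite inE us orbT.
lia.
Qed.

Lemma size_of_seq (s : seq tree) : size s < tsize (of_seq s).
Proof. elim: s => //= t s; have := tsize_gt0 t; lia. Qed.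

(** Padding with [None] codes a sequence of length at most 3 injectively as a function from three
    positions to [option T]. *)
Lemma size_short_seqs (T : finType) (s : seq (seq T)) :
  uniq s -> all (fun C => size C <= 3) s -> size s <= #|T|.+1 ^ 3.
Proof.
move=> us /allP s3.
pose code (C : seq T) : {ffun 'I_3 -> option T} :=
  [ffun i : 'I_3 => nth None (map some C) i].
have code_inj : {in s &, injective code}.
  move=> C D Cs Ds /ffunP CD.
  suff : map some C = map some D by apply: inj_map => x y [].
  have nthE k : nth None (map some C) k = nth None (map some D) k.
    have [k3|k3] := ltnP k 3; first by have := CD (Ordinal k3); rewrite !ffunE.
    by rewrite !nth_default ?size_map // (leq_trans (s3 _ _) k3).
  have size_le (A B : seq T) : (forall k, nth None (map some A) k =
      nth None (map some B) k) -> size A <= size B.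
    move=> AB; rewrite leqNgt; apply/negP => lt.
    have := AB (size B); rewrite [RHS]nth_default ?size_map //.
    by case: A lt {AB} => // x A lt; rewrite (nth_map x).
  apply: (eq_from_nth (x0 := None)) => [|k _]; last exact: nthE.
  by rewrite !size_map; apply/eqP; rewrite eqn_leq !size_le.
have -> : #|T|.+1 ^ 3 = #|{: {ffun 'I_3 -> option T}}|.
  by rewrite card_ffun card_option card_ord.
by rewrite -(size_map code) -(card_uniqP _) ?max_card // map_inj_in_uniq.
Qed.

(** Without repetitions there are at most [(2 * n + 1) ^ 3] clauses, each encoded in size at most
    [6 * n + 16]. So polynomial in the input size means polynomial in [n]. *)
Lemma tsize_enc_sat3 x : tsize (enc_sat3 x) <= (sat3_nvars x).+2 ^ 12.
Proof.
set n := sat3_nvars x; set phi := sat3_cnf x.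
have lit_le (l : literal n) : tsize (enc_literal l) <= 2 * n + 4.
  have := ltn_ord l.1.
  rewrite -[tsize _]/(tsize (enc_nat l.1) + tsize (enc_bool l.2)).+1.
  rewrite tsize_enc_nat; case: (l.2) => /=; lia.
have C_le (C : clause n) : C \in (phi : seq (seq ('I_n * bool))) ->
    tsize (enc_seq (@enc_literal n) C) <= 6 * n + 16.
  move=> Cphi; rewrite enc_seqE.
  have /tsize_of_seq : forall t, t \in map (@enc_literal n) C -> tsize t <= 2 * n + 4.
    by move=> _ /mapP[l _ ->].
  rewrite size_map => /leq_trans; apply.
  apply: leq_trans (_ : 3 * (2 * n + 4).+1 + 1 <= _); last by lia.
  by rewrite leq_add2r leq_mul2r (allP (sat3_width x) C Cphi) orbT.
have m_le : size phi <= (2 * n).+1 ^ 3.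
  have := size_short_seqs (sat3_uniq x) (sat3_width x).
  by rewrite card_prod card_ord card_bool mulnC.
have phi_le : tsize (enc_cnf phi) <= size phi * (6 * n + 16).+1 + 1.
  have /tsize_of_seq : forall t, t \in items (enc_cnf phi) -> tsize t <= 6 * n + 16.
    move=> t; rewrite items_enc_cnf => /mapP[C Cphi ->].
    by rewrite -enc_seqE; exact: C_le.
  by rewrite itemsK items_enc_cnf size_map.
rewrite -[tsize _]/(tsize (enc_nat n) + tsize (enc_cnf phi)).+1 tsize_enc_nat.
have : size phi * (6 * n + 16).+1 <= (2 * n).+1 ^ 3 * (6 * n + 16).+1.
  by rewrite leq_mul2r m_le orbT.
set Y := (2 * n).+1 ^ 3 * _ => phiY.
apply: leq_trans (_ : Y + 2 * n + 3 <= _); first by lia.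
apply: leq_trans (_ : 2 ^ 8 * n.+1 ^ 4 <= _); last first.
  by rewrite (_ : 12 = 8 + 4) // expnD leq_mul // leq_base_exp.
by rewrite /Y !expnS !expn0; nia.
Qed.

Lemma size_cover n : size (cover_vertices n) =
  3 * size (groups n) + 3 * 2 ^ log4 n.
Proof.
rewrite /cover_vertices /grpV /palV /enc_groups.
by rewrite catrevE size_cat size_rev size_allpairs !size_map size_palette.
Qed.

(** The parameter grows at least like the square root of [n], so the asymptotic hypothesis on [f]
    applies to it once [n] is large. *)
Lemma cover_lb n : n < size (cover_vertices n) ^ 2.
Proof.
rewrite size_cover; apply: leq_trans (log4_ub n) _.
by rewrite (_ : 4 = 2 ^ 2) // -expnM mulnC expnM leq_base_exp //; lia.
Qed.

(** The groups contribute about [n] per copy. For the words, with [b.+1] for [log4 n], one has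
    [2 ^ b * b.+1 <= 4 ^ b <= n]. *)
Lemma cover_mul_log4 n : size (cover_vertices n) * log4 n <= 12 * n.
Proof.
rewrite size_cover; have [l0|l0] := posnP (log4 n); first by rewrite l0 muln0.
have lb := log4_lb l0; have [_ gb] := groups_size n; have g0 := groups_gt0 n.
move: l0 lb gb; case: (log4 n) => // b _ lb gb.
have bp := ltn_expl b (isT : 1 < 2).
have pp : 2 ^ b * 2 ^ b <= n.
  by apply: leq_trans lb; rewrite -expnMn /= (_ : 2 * 2 = 4).
rewrite expnS; move: pp bp g0 gb.
by move: (2 ^ b) (size (groups n)) => p [|g] //= pp bp _ gb; nia.
Qed.

(** A crude bound suffices, since only the logarithm of the cover size is needed: it becomes
    [O(log4 n)]. *)
Lemma cover_ub n : 0 < n -> size (cover_vertices n) <= 2 ^ (6 * log4 n).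
Proof.
move=> n0; have l0 := log4_gt0 n0.
apply: leq_trans (leq_pmulr _ l0) _; apply: leq_trans (cover_mul_log4 n) _.
have B16 : 2 ^ 4 <= 2 ^ (4 * log4 n) by rewrite leq_exp2l // leq_pmulr.
rewrite (mulnDl 2 4 (log4 n)) expnD [2 ^ (2 * _)]expnM (_ : 2 ^ 2 = 4) //.
apply: leq_trans (leq_mul (ltnW (log4_ub n)) B16).
by rewrite mulnC leq_mul2l orbT.
Qed.

Lemma reduce_time : exists A, forall x,
  cost FReduce (enc_sat3 x) + 2 * (height FReduce).+1 <=
  (sat3_nvars x).+2 ^ A.
Proof.
have [[e ce] _] := poly_FReduce.
(* The 13 is the exponent 12 of the input size, raised by one to absorb the successor in [polyb].
   The final successor supplies a factor 2 that turns a sum into a product. *)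
move: (2 * _) => Q; exists (13 * e + Q).+1 => x.
set m := (sat3_nvars x).+2.
have m2 : 1 < m by [].
have t13 : (tsize (enc_sat3 x)).+1 <= m ^ 13.
  apply: leq_trans (_ : (m ^ 12).+1 <= _); first by rewrite ltnS tsize_enc_sat3.
  by rewrite ltn_exp2l.
have h1 : cost FReduce (enc_sat3 x) <= m ^ (13 * e).
  by rewrite expnM; apply: leq_trans (ce _) (leq_base_exp _ t13).
have h2 : Q <= m ^ Q := ltnW (ltn_expl Q m2).
have g1 : 0 < m ^ (13 * e) by rewrite expn_gt0.
have g2 : 0 < m ^ Q by rewrite expn_gt0.
rewrite expnS expnD; move: (m) m2 (m ^ (13 * e)) (m ^ Q) h1 h2 g1 g2.
move: (cost _ _) => c n n2 u v cu Qv u0 v0.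
apply: leq_trans (_ : 2 * (u * v) <= _); first by nia.
by rewrite leq_mul2r n2 orbT.
Qed.

(** The output contains an adjacency row for every vertex, so its polynomial size bounds the
    order. *)
Lemma reduce_order : exists B, forall x,
  (ci_order (reduce x)).+1 <= (sat3_nvars x).+2 ^ B.
Proof.
have [_ [e se]] := poly_FReduce.
exists (13 * e) => x; set m := (sat3_nvars x).+2.
have t13 : (tsize (enc_sat3 x)).+1 <= m ^ 13.
  apply: leq_trans (_ : (m ^ 12).+1 <= _); first by rewrite ltnS tsize_enc_sat3.
  by rewrite ltn_exp2l.
rewrite expnM; apply: leq_trans (leq_base_exp _ t13).
apply: leq_trans (se _).
rewrite run_FReduce_sat3 enc_reduction /out.
set s := map _ _; have := size_of_seq s; rewrite size_map => sV.
by apply: leq_trans sV _; rewrite [tsize (Node _ _)]/= ltnW // ltnS leq_addr.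
Qed.

(** * Asymptotics *)

Local Close Scope nat_scope.
Import Order.TTheory GRing.Theory Num.Theory numFieldNormedType.Exports.
Local Open Scope classical_set_scope.
Local Open Scope ring_scope.

(** With [k] the cover size and [b = log4 n], [ln k <= 6 * b * ln 2 <= 12 * b] and
    [k * b <= 12 * n]; hence 144. *)
Lemma cover_entropy (R : realType) n : (0 < n)%N ->
  (size (cover_vertices n))%:R * ln (size (cover_vertices n))%:R <=
  144 * n%:R :> R.
Proof.
move=> n0; have k2 := cover_lb n; have kb := cover_mul_log4 n.
have ku := cover_ub n0.
move: (size _) (log4 n) k2 kb ku => k b k2 kb ku.
have k0 : (0 < k)%N by move: k2; case: k {kb ku} => //; rewrite ltn0.
have kR : 0 < k%:R :> R by rewrite ltr0n.
have lnk : ln k%:R <= 12 * b%:R :> R.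
  apply: le_trans (_ : ln ((2 : R) ^+ (6 * b)) <= _).
    by rewrite ler_ln ?posrE ?exprn_gt0 // -natrX ler_nat.
  rewrite lnXn // -[ln 2 *+ _]mulr_natl natrM.
  have : ln 2 < 2 :> R by rewrite ln_sublinear.
  have : 0 <= b%:R :> R by rewrite ler0n.
  nra.
have : k%:R * b%:R <= 12 * n%:R :> R by rewrite -!natrM ler_nat.
nra.
Qed.

(** The logarithm of [n + 2] is twice that of its square root, hence less than twice the root;
    squared, the claim follows from [4 * (n + 2) <= 8 * n <= e ^ 2 * n ^ 2]. *)
Lemma ln_le_linear (R : realType) (n : nat) (e : R) : 0 < e -> (2 <= n)%N ->
  8 / e ^+ 2 <= n%:R -> ln n.+2%:R <= e * n%:R.
Proof.
move=> e0 n2 ne; have nR : 2 <= n%:R :> R by rewrite ler_nat.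
have m0 : 0 < n.+2%:R :> R by rewrite ltr0n.
have s0 : 0 < Num.sqrt n.+2%:R :> R by rewrite sqrtr_gt0.
rewrite -[in leLHS](sqr_sqrtr (ltW m0)) lnXn //.
have := ln_sublinear s0.
suff : Num.sqrt n.+2%:R *+ 2 <= e * n%:R by rewrite !mulr2n; lra.
rewrite ler_pdivrMr ?exprn_gt0 // in ne.
rewrite -(ler_pXn2r (_ : 0 < 2)%N)
  ?nnegrE ?mulrn_wge0 ?mulr_ge0 ?(ltW s0) ?(ltW e0) //.
rewrite -[Num.sqrt _ *+ 2]mulr_natl !exprMn sqr_sqrtr ?(ltW m0) //.
rewrite -[n.+2%N]addn2 natrD.
nra.
Qed.

Lemma littleo_natP (R : realType) (f g : nat -> R) :
  f =o_\oo g <-> forall e : R, 0 < e ->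
    exists N, forall n, (N <= n)%N -> `|f n| <= e * `|g n|.
Proof.
split=> [/eqoP h e /h[N _ hN]|h]; first by exists N => n Nn; exact: hN.
by apply/eqoP => e /h[N hN]; exists N.
Qed.

(** This is the exponent of the resulting 3SAT algorithm: the first summand comes from the colouring
    algorithm, the second writes the polynomial factor [n.+2 ^ D] as a power of 2. *)
Lemma sat_exponent (R : realType) (f : nat -> R) (D : nat) :
  f =o_\oo (fun k : nat => k%:R * ln k%:R : R) ->
  (fun n => `|f (size (cover_vertices n))| + D%:R * (ln n.+2%:R / ln 2))
    =o_\oo (fun n : nat => n%:R : R).
Proof.
move=> /littleo_natP fo; apply/littleo_natP => e e0.
have l2 : 0 < ln 2 :> R by rewrite ln_gt0 // ltr1n.
(* Twice the 144 of [cover_entropy], so that each summand gets half of [e]. *)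
have e288 : 0 < e / 288 by lra.
have [K hK] := fo _ e288.
(* Chosen so that [D.+1 * d / ln 2 = e / 2]; the successor avoids a division by zero. *)
pose d := e * ln 2 / (2 * D.+1%:R) : R.
have D0 : 0 < D.+1%:R :> R by rewrite ltr0n.
have d0 : 0 < d by rewrite divr_gt0 // mulr_gt0.
have [M hM] : exists M : nat, 8 / d ^+ 2 <= M%:R.
  exists (Num.truncn (8 / d ^+ 2)).+1%N; exact/ltW/truncnS_gt.
exists (maxn (K ^ 2) (maxn M 2)) => n; rewrite !geq_max => /and3P[nK nM n2].
have kK : (K <= size (cover_vertices n))%N.
  rewrite -(leq_exp2r _ _ (isT : 0 < 2)%N); apply: leq_trans nK _.
  exact/ltnW/cover_lb.
have n0 : (0 < n)%N by apply: leq_trans n2.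
have fk := hK _ kK; have ent := cover_entropy R n0.
have lnn : ln n.+2%:R <= d * n%:R :> R.
  by apply: ln_le_linear => //; apply: le_trans hM _; rewrite ler_nat.
have k1 : (1 <= size (cover_vertices n))%N.
  by have := cover_lb n; case: size => //; rewrite ltn0.
have lnk0 : 0 <= ln (size (cover_vertices n))%:R :> R by rewrite ln_ge0 // ler1n.
have ln0 : 0 <= ln n.+2%:R :> R by rewrite ln_ge0 // ler1n.
have q0 := mulr_ge0 (ler0n R D) (divr_ge0 ln0 (ltW l2)).
rewrite (ger0_norm (addr_ge0 (normr_ge0 _) q0)).
rewrite (ger0_norm (ler0n R n)).
rewrite (ger0_norm (mulr_ge0 (ler0n R _) lnk0)) in fk.
have h1 : `|f (size (cover_vertices n))| <= e / 2 * n%:R.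
  apply: le_trans fk _; rewrite -(ler_pM2l e288) in ent.
  by apply: le_trans ent _; lra.
have h2 : D%:R * (ln n.+2%:R / ln 2) <= e / 2 * n%:R.
  rewrite mulrA ler_pdivrMr //.
  apply: le_trans (_ : D.+1%:R * (d * n%:R) <= _).
    by rewrite ler_pM ?ler_nat.
  have D1 : D.+1%:R != 0 :> R by rewrite gt_eqF.
  by have -> : D.+1%:R * (d * n%:R) = e / 2 * n%:R * ln 2 by rewrite /d; field.
lra.
Qed.
Lemma expR_log2 (R : realType) (m D : nat) : (0 < m)%N ->
  2 `^ (D%:R * (ln m%:R / ln 2)) = m%:R ^+ D :> R.
Proof.
move=> m0; have l2 : ln 2 != 0 :> R by rewrite gt_eqF // ln_gt0 // ltr1n.
rewrite mulrC powRrM powR_mulrn ?powR_ge0 //; congr (_ ^+ _).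
by rewrite /powR pnatr_eq0 /= divfK // lnK // posrE ltr0n.
Qed.

Unset Implicit Arguments.

(* In the time bound, [(ci_order x).+1] stands for the number of vertices, so
   that the factor does not vanish on the empty graph. *)
Theorem theorem19 (R : realType) :
  ETH R ->
  ~ exists (p : cmd) (f : nat -> R) (c : nat),
      f =o_\oo (fun k : nat => k%:R * ln k%:R : R) /\
      decides_in_time enc_chromatic chromatic_yes
        (fun x => 2 `^ f (ci_k x) * (ci_order x).+1%:R ^+ c) p.
Proof.
move=> eth [p [f [c [fo dec]]]]; apply: eth.
have [A hA] := reduce_time; have [B hB] := reduce_order.
(* [A] pays for the reduction, [B * c] for the power of the order, and the successor for a factor of
   at least 2 that absorbs the sum of the two running times. *)
pose D := (A + B * c).+1%N.
exists (after FReduce p), (fun n => `|f (size (cover_vertices n))| +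
  D%:R * (ln n.+2%:R / ln 2)); split; first exact: sat_exponent.
move=> x; have [t [s [ep tb ans]]] := dec (reduce x).
rewrite -run_FReduce_sat3 in ep.
have [t' e' tt'] := exec_after ep.
exists t', s; split=> //; last by rewrite ans reduce_correct.
rewrite powRD ?pnatr_eq0 ?implybT // expR_log2 //.
set n := sat3_nvars x; set Z := 2 `^ _.
have Z1 : 1 <= Z by rewrite -(powRr0 2) ler_powR ?ler1n.
have fZ : 2 `^ f (ci_k (reduce x)) <= Z by rewrite ler_powR ?ler1n // ler_norm.
set m : R := n.+2%:R.
have m2 : 2 <= m by rewrite ler_nat.
have NB : (ci_order (reduce x)).+1%:R ^+ c <= m ^+ (B * c).
  by rewrite exprM lerXn2r ?nnegrE ?exprn_ge0 // -natrX ler_nat; exact: hB.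
have CA : (cost FReduce (enc_sat3 x) + 2 * (height FReduce).+1)%:R <= m ^+ A.
  by rewrite -natrX ler_nat; exact: hA.
have t'le : t'%:R <= m ^+ A + t%:R.
  apply: le_trans
    (_ : (cost FReduce (enc_sat3 x) + 2 * (height FReduce).+1 + t)%:R <= _).
    by rewrite ler_nat.
  by rewrite natrD lerD2r.
apply: le_trans t'le _.
have a1 : 1 <= m ^+ A by rewrite exprn_ege1 // (le_trans _ m2) // ler1n.
have b1 : 1 <= m ^+ (B * c) by rewrite exprn_ege1 // (le_trans _ m2) // ler1n.
have tle : t%:R <= Z * m ^+ (B * c).
  by apply: le_trans tb _; rewrite ler_pM ?powR_ge0 ?exprn_ge0.
rewrite /D exprS exprD; move: (m ^+ A) (m ^+ (B * c)) a1 b1 tle => u v u1 v1 tle.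
have zv1 : 1 <= Z * v by rewrite -[1]mulr1 ler_pM.
apply: le_trans (_ : 2 * (u * (Z * v)) <= _); first by nra.
have -> : Z * (m * (u * v)) = m * (u * (Z * v)) by ring.
by rewrite ler_wpM2r // mulr_ge0 // (le_trans ler01).
Qed.
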